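(* Let $k \geq 1$. There are functionals definable in ${\mathrm{PCF}}_{k+1}$ but not in ${\mathrm{PCF}}^\Omega_k$. More specifically: (i) There is no closed term $M$ of ${\mathrm{PCF}}^\Omega_k$ such that $M \simeq Y_{\mathbb{N} \rightarrow \overline{k+1}}$ (or equivalently $M \sim_0 Y_{\mathbb{N} \rightarrow \overline{k+1}}$). (ii) There is no closed term $M$ of ${\mathrm{PCF}}^\Omega_k$ such that $M \simeq Y_{\overline{k+1}}$.
   Context: Types are generated by $\sigma ::= \mathbb{N} \mid \sigma\rightarrow\sigma$; the level is ${\mathrm{lv}}(\mathbb{N})=0$, ${\mathrm{lv}}(\sigma\rightarrow\tau)=\max({\mathrm{lv}}(\sigma)+1,{\mathrm{lv}}(\tau))$; the pure types are $\overline{0}=\mathbb{N}$, $\overline{k+1}=\overline{k}\rightarrow\mathbb{N}$. ${\mathrm{PCF}}$ is the simply typed $\lambda$-calculus over the base type $\mathbb{N}$ with constants $\underline{n}:\mathbb{N}$ ($n\in\mathbb{N}$), $\mathit{suc},\mathit{pre}:\mathbb{N}\rightarrow\mathbb{N}$, $\mathit{ifzero}:\mathbb{N}\rightarrow\mathbb{N}\rightarrow\mathbb{N}\rightarrow\mathbb{N}$ and $Y_\sigma:(\sigma\rightarrow\sigma)\rightarrow\sigma$ for every type $\sigma$. ${\mathrm{PCF}}^\Omega$ additionally has a constant $C_f:\mathbb{N}\rightarrow\mathbb{N}$ for every partial function $f:\mathbb{N}\rightharpoonup\mathbb{N}$. ${\mathrm{PCF}}_k$ (resp. ${\mathrm{PCF}}^\Omega_k$)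 is the sublanguage of ${\mathrm{PCF}}$ (resp. ${\mathrm{PCF}}^\Omega$) in which $Y_\sigma$ is admitted only for ${\mathrm{lv}}(\sigma)\leq k$. Closed terms reduce by the rules $(\lambda x.M)N \rightsquigarrow M[x\mapsto N]$, $\mathit{suc}\,\underline{n}\rightsquigarrow\underline{n+1}$, $\mathit{pre}\,\underline{n+1}\rightsquigarrow\underline{n}$, $\mathit{pre}\,\underline{0}\rightsquigarrow\underline{0}$, $\mathit{ifzero}\,\underline{0}\rightsquigarrow\lambda xy.x$, $\mathit{ifzero}\,\underline{n+1}\rightsquigarrow\lambda xy.y$, $Y_\sigma M\rightsquigarrow M(Y_\sigma M)$, $C_f\,\underline{n}\rightsquigarrow\underline{m}$ whenever $f(n)=m$, closed under the evaluation contexts $[-]N$, $\mathit{suc}\,[-]$, $\mathit{pre}\,[-]$, $\mathit{ifzero}\,[-]$; $\rightsquigarrow^*$ is the reflexive-transitive closure. For closed terms $M,M'$ of the same type, $M\simeq M'$ (observational equivalence) means that for every closed program context $C[-]:\mathbb{N}$ of ${\mathrm{PCF}}^\Omega$ and every $n$, $C[M]\rightsquigarrow^*\underline{n}$ iff $C[M']\rightsquigarrow^*\underline{n}$ (this relation is the same whether contexts range over ${\mathrm{PCF}}_0$, ${\mathrm{PCF}}_k$, ${\mathrm{PCF}}$ or ${\mathrm{PCF}}^\Omega$). For $M,M':\sigma_0\rightarrow\cdots\rightarrow\sigma_{r-1}\rightarrow\mathbb{N}$, $M\sim_0 M'$ means that for all closed ${\mathrm{PCF}}_0$ terms $N_i:\sigma_i$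 and all $n$, $MN_0\ldots N_{r-1}\rightsquigarrow^*\underline{n}$ iff $M'N_0\ldots N_{r-1}\rightsquigarrow^*\underline{n}$. *)

(* Defs.v *)
From Stdlib Require Import Arith List.
Import ListNotations.

Inductive ty : Type :=
| TN : ty
| TArr : ty -> ty -> ty.

Fixpoint lv (s : ty) : nat :=
  match s with
  | TN => 0
  | TArr a b => Nat.max (lv a + 1) (lv b)
  end.

Fixpoint pure (k : nat) : ty :=
  match k with
  | 0 => TN
  | S k' => TArr (pure k') TN
  end.

(* Constants.  COracle f is C_f for the partial function f : N -> N
   (represented as nat -> option nat). *)
Inductive const : Type :=
| CNum : nat -> const
| CSuc : const
| CPre : const
| CIfz : const
| CY : ty -> const
| COracle : (nat -> option nat) -> const.

(* Terms, Church-style lambda with de Bruijn indices. *)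
Inductive tm : Type :=
| Var : nat -> tm
| Lam : ty -> tm -> tm
| App : tm -> tm -> tm
| Const : const -> tm.

Definition const_type (c : const) : ty :=
  match c with
  | CNum _ => TN
  | CSuc => TArr TN TN
  | CPre => TArr TN TN
  | CIfz => TArr TN (TArr TN (TArr TN TN))
  | CY s => TArr (TArr s s) s
  | COracle _ => TArr TN TN
  end.

Inductive has_type : list ty -> tm -> ty -> Prop :=
| T_Var : forall G n s, nth_error G n = Some s -> has_type G (Var n) s
| T_Lam : forall G s t M, has_type (s :: G) M t -> has_type G (Lam s M) (TArr s t)
| T_App : forall G s t M N, has_type G M (TArr s t) -> has_type G N s ->
    has_type G (App M N) t
| T_Const : forall G c, has_type G (Const c) (const_type c).

Definition const_fix_le (k : nat) (c : const) : Prop :=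
  match c with CY s => lv s <= k | _ => True end.
Definition const_no_oracle (c : const) : Prop :=
  match c with COracle _ => False | _ => True end.

Fixpoint all_consts (P : const -> Prop) (M : tm) : Prop :=
  match M with
  | Var _ => True
  | Lam _ M => all_consts P M
  | App M N => all_consts P M /\ all_consts P N
  | Const c => P c
  end.

Definition in_PCFOmega_k (k : nat) (M : tm) : Prop := all_consts (const_fix_le k) M.
Definition in_PCF_k (k : nat) (M : tm) : Prop :=
  all_consts (const_fix_le k) M /\ all_consts const_no_oracle M.

Fixpoint shift (c : nat) (M : tm) : tm :=
  match M with
  | Var n => if c <=? n then Var (S n) else Var n
  | Lam s M => Lam s (shift (S c) M)
  | App M N => App (shift c M) (shift c N)
  | Const k => Const k
  end.

Fixpoint subst (j : nat) (N : tm) (M : tm) : tm :=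
  match M with
  | Var n => if n =? j then N else if j <? n then Var (pred n) else Var n
  | Lam s M => Lam s (subst (S j) (shift 0 N) M)
  | App M1 M2 => App (subst j N M1) (subst j N M2)
  | Const k => Const k
  end.

Definition num (n : nat) : tm := Const (CNum n).

Inductive step : tm -> tm -> Prop :=
| S_Beta : forall s M N, step (App (Lam s M) N) (subst 0 N M)
| S_Suc : forall n, step (App (Const CSuc) (num n)) (num (S n))
| S_PreS : forall n, step (App (Const CPre) (num (S n))) (num n)
| S_Pre0 : step (App (Const CPre) (num 0)) (num 0)
| S_Ifz0 : step (App (Const CIfz) (num 0)) (Lam TN (Lam TN (Var 1)))
| S_IfzS : forall n, step (App (Const CIfz) (num (S n))) (Lam TN (Lam TN (Var 0)))
| S_Y : forall s M, step (App (Const (CY s)) M) (App M (App (Const (CY s)) M))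
| S_Oracle : forall f n m, f n = Some m -> step (App (Const (COracle f)) (num n)) (num m)
| S_AppL : forall M M' N, step M M' -> step (App M N) (App M' N)
| S_SucC : forall M M', step M M' -> step (App (Const CSuc) M) (App (Const CSuc) M')
| S_PreC : forall M M', step M M' -> step (App (Const CPre) M) (App (Const CPre) M')
| S_IfzC : forall M M', step M M' -> step (App (Const CIfz) M) (App (Const CIfz) M').

Inductive steps : tm -> tm -> Prop :=
| steps_refl : forall M, steps M M
| steps_step : forall M M' M'', step M M' -> steps M' M'' -> steps M M''.

Inductive ctx : Type :=
| CHole : ctx
| CVar : nat -> ctx
| CLam : ty -> ctx -> ctx
| CApp : ctx -> ctx -> ctx
| CConst : const -> ctx.

Fixpoint plug (C : ctx) (M : tm) : tm :=
  match C with
  | CHole => M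
  | CVar n => Var n
  | CLam s C => Lam s (plug C M)
  | CApp C1 C2 => App (plug C1 M) (plug C2 M)
  | CConst c => Const c
  end.

Inductive ctx_typed : list ty -> ctx -> ty -> ty -> Prop :=
| CT_Hole : forall G s, ctx_typed G CHole s s
| CT_Var : forall G n s t, nth_error G n = Some t -> ctx_typed G (CVar n) s t
| CT_Lam : forall G s a b C, ctx_typed (a :: G) C s b -> ctx_typed G (CLam a C) s (TArr a b)
| CT_App : forall G s a b C1 C2, ctx_typed G C1 s (TArr a b) -> ctx_typed G C2 s a ->
    ctx_typed G (CApp C1 C2) s b
| CT_Const : forall G s c, ctx_typed G (CConst c) s (const_type c).

Definition obs_equiv (s : ty) (M M' : tm) : Prop :=
  forall C, ctx_typed [] C s TN ->
    forall n, steps (plug C M) (num n) <-> steps (plug C M') (num n).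

Fixpoint args_ok (s : ty) (Ns : list tm) : Prop :=
  match s, Ns with
  | TN, [] => True
  | TArr a b, N :: Ns' => (has_type [] N a /\ in_PCF_k 0 N) /\ args_ok b Ns'
  | _, _ => False
  end.

Definition apps (M : tm) (Ns : list tm) : tm := fold_left App Ns M.

Definition sim0 (s : ty) (M M' : tm) : Prop :=
  forall Ns, args_ok s Ns ->
    forall n, steps (apps M Ns) (num n) <-> steps (apps M' Ns) (num n).

(* Main.v *)
(* A fixed point operator of level k+1 can iterate a functional
   [F : (pure k -> N) -> pure k -> N] along a list whose nodes are objects of type [pure k];
   a term of PCF_k cannot, since a recursion of level k only has parameters of level at most
   k-1 and so cannot carry a node.

   The nodes are keys [e_0^k, .., e_i^k], where [e_n^j] answers a secret [r_n^j] only to an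
   argument that behaves like [e_n^(j-1)], and the test functional [F_i], called with the n-th
   key and a continuation, gives the continuation the (n+1)-st key; the answer [s], another
   secret, appears at the end of the list.  Thus [Y F_i e_0 = s], for all i and all secrets.

   Given M in PCF_k, consider the family of the values of [M F_i e_0] over all secrets.  Two
   logical relations, whose base conditions read "if the family is total on a class of
   assignments of secrets then it is constant there", describe what M can know.  The Kripke
   relation [K] concerns one key: its worlds record which of the [e_n^j] are in scope, and the
   boundary lemma says that up to level k-1 it does not matter whether the key [e_n^k] is in
   scope.  The relation [MM] concerns the whole run, for almost all i: at high types its worlds
   record that at most the keys [0, .., a] are in scope, and at types of level at most k it is
   given by a condition on each i, so that it is preserved by the fixed point operators of
   PCF_k whatever the number of unfoldings.  The functional [F_i] is in [MM], because from scope
   [a] it only reaches scope [a + 1].  Hence for large i the value of [M F_i e_0] does not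
   depend on s. *)
From Stdlib Require Import Arith List Lia Bool Classical ClassicalEpsilon.
From Stdlib Require Import FunctionalExtensionality Eqdep_dec.
Require Import Defs.
Import ListNotations.

(** * Denotational semantics with fuel *)

Lemma ty_eq_dec (a b : ty) : {a = b} + {a <> b}.
Proof. decide equality. Defined.

Lemma ty_uip (a : ty) (e : a = a) : e = eq_refl.
Proof. apply UIP_dec, ty_eq_dec. Qed.

(** Full function spaces suffice: with fuel a fixed point is a finite iterate, so neither order nor
    continuity has to be built in. *)
Fixpoint D (s : ty) : Type :=
  match s with
  | TN => option nat
  | TArr a b => D a -> D b
  end.

Fixpoint bot (s : ty) : D s :=
  match s with
  | TN => None
  | TArr a b => fun _ => bot b
  end.

Definition val : Type := {s : ty & D s}.

Definition coerce (v : val) (s : ty) : D s :=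
  match ty_eq_dec (projT1 v) s with
  | left e => eq_rect (projT1 v) D (projT2 v) s e
  | right _ => bot s
  end.

Lemma coerce_same (s : ty) (x : D s) : coerce (existT D s x) s = x.
Proof.
  unfold coerce; simpl. destruct (ty_eq_dec s s) as [e|n].
  - rewrite (ty_uip s e). reflexivity.
  - contradiction n; reflexivity.
Qed.

Fixpoint iter {X : Type} (m : nat) (f : X -> X) (x : X) : X :=
  match m with
  | 0 => x
  | S m' => f (iter m' f x)
  end.

(* The argument [m] is a fuel: every fixed point operator is unrolled [m] times. *)
Definition cden (m : nat) (c : const) : D (const_type c) :=
  match c return D (const_type c) with
  | CNum n => Some n
  | CSuc => fun x => match x with Some n => Some (S n) | None => None end
  | CPre => fun x => match x with Some n => Some (pred n) | None => None end
  | CIfz => fun x y z =>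
      match x with Some 0 => y | Some (S _) => z | None => None end
  | CY s => fun f => iter m f (bot s)
  | COracle f => fun x => match x with Some n => f n | None => None end
  end.

Fixpoint tyof (G : list ty) (t : tm) : option ty :=
  match t with
  | Var n => nth_error G n
  | Lam a t =>
      match tyof (a :: G) t with Some b => Some (TArr a b) | None => None end
  | App t u =>
      match tyof G t with Some (TArr _ b) => Some b | _ => None end
  | Const c => Some (const_type c)
  end.

Lemma tyof_has_type G t s : has_type G t s -> tyof G t = Some s.
Proof.
  induction 1; simpl; auto.
  - now rewrite IHhas_type.
  - now rewrite IHhas_type1.
Qed.

Definition types (e : list val) : list ty := map (@projT1 ty D) e.

Lemma types_app e1 e2 : types (e1 ++ e2) = types e1 ++ types e2.
Proof. apply map_app. Qed.

(** Recursion on raw terms instead of typing derivations: [tyof] recovers the type of an argument,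
    and ill-typed places get [bot]. *)
Fixpoint den (m : nat) (t : tm) (s : ty) (e : list val) {struct t} : D s :=
  match t with
  | Var n => match nth_error e n with Some v => coerce v s | None => bot s end
  | Lam _ t =>
      match s return D s with
      | TN => None
      | TArr a b => fun x => den m t b (existT D a x :: e)
      end
  | App t u =>
      match tyof (types e) u with
      | Some a => den m t (TArr a s) e (den m u a e)
      | None => bot s
      end
  | Const c => coerce (existT D (const_type c) (cden m c)) s
  end.

Lemma den_app m t u a s e :
  has_type (types e) u a ->
  den m (App t u) s e = den m t (TArr a s) e (den m u a e).
Proof. intro H; simpl. now rewrite (tyof_has_type _ _ _ H). Qed.

Lemma den_const m c e : den m (Const c) (const_type c) e = cden m c.
Proof. apply coerce_same. Qed.

(** * Weakening and substitution of closed terms *)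

Lemma has_type_weaken G G' t s : has_type G t s -> has_type (G ++ G') t s.
Proof.
  induction 1; simpl in *; try (econstructor; eauto; fail).
  constructor. rewrite nth_error_app1; auto.
  apply nth_error_Some. congruence.
Qed.

Lemma closed_weaken G t s : has_type [] t s -> has_type G t s.
Proof. exact (has_type_weaken [] G t s). Qed.

Lemma shift_closed_above G t s c :
  has_type G t s -> length G <= c -> shift c t = t.
Proof.
  intro H; revert c; induction H; intros d Hd; simpl.
  - destruct (Nat.leb_spec d n); auto.
    assert (n < length G) by (apply nth_error_Some; congruence). lia.
  - rewrite IHhas_type; auto. simpl; lia.
  - now rewrite IHhas_type1, IHhas_type2.
  - auto.
Qed.

Lemma subst_closed_above G t s j N :
  has_type G t s -> length G <= j -> subst j N t = t.
Proof.
  intro H; revert j N; induction H; intros j N' Hj; simpl.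
  - assert (n < length G) by (apply nth_error_Some; congruence).
    destruct (Nat.eqb_spec n j); [lia|]. destruct (Nat.ltb_spec j n); [lia|auto].
  - rewrite IHhas_type; auto. simpl; lia.
  - now rewrite IHhas_type1, IHhas_type2.
  - auto.
Qed.

Lemma shift_closed t s c : has_type [] t s -> shift c t = t.
Proof. intro H; apply (shift_closed_above _ _ _ _ H). simpl; lia. Qed.

Lemma subst_closed t s j N : has_type [] t s -> subst j N t = t.
Proof. intro H; apply (subst_closed_above _ _ _ _ _ H). simpl; lia. Qed.

Lemma has_type_subst G1 G2 a t s N :
  has_type (G1 ++ a :: G2) t s -> has_type [] N a ->
  has_type (G1 ++ G2) (subst (length G1) N t) s.
Proof.
  intros H HN. remember (G1 ++ a :: G2) as G eqn:EG. revert G1 EG.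
  induction H; intros G1 EG; subst G; simpl.
  - destruct (Nat.eqb_spec n (length G1)).
    + subst n. rewrite nth_error_app2, Nat.sub_diag in H by lia.
      simpl in H. injection H as <-. now apply closed_weaken.
    + destruct (Nat.ltb_spec (length G1) n).
      * constructor. rewrite nth_error_app2 in H |- * by lia.
        replace (n - length G1) with (S (pred n - length G1)) in H by lia. exact H.
      * constructor. rewrite nth_error_app1 in H |- * by lia. exact H.
  - constructor. rewrite (shift_closed _ _ _ HN).
    apply (IHhas_type (s :: G1)). reflexivity.
  - econstructor; eauto.
  - constructor.
Qed.

Lemma den_weaken m G t s e1 e2 :
  has_type G t s -> types e1 = G -> den m t s (e1 ++ e2) = den m t s e1.
Proof.
  intro H; revert e1; induction H; intros e1 E; subst.
  - simpl. rewrite nth_error_app1; auto.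
    assert (n < length (types e1)) by (apply nth_error_Some; congruence).
    unfold types in H0. now rewrite length_map in H0.
  - simpl. extensionality x. apply (IHhas_type (existT D s x :: e1)). reflexivity.
  - rewrite !(den_app _ _ _ s); auto.
    + now rewrite IHhas_type1, IHhas_type2.
    + rewrite types_app; now apply has_type_weaken.
  - reflexivity.
Qed.

Lemma den_closed m t s e : has_type [] t s -> den m t s e = den m t s [].
Proof. intro H. exact (den_weaken m [] t s [] e H eq_refl). Qed.

Lemma den_subst m G1 G2 a t s N e1 e2 :
  has_type (G1 ++ a :: G2) t s -> has_type [] N a ->
  types e1 = G1 -> types e2 = G2 ->
  den m (subst (length G1) N t) s (e1 ++ e2) =
  den m t s (e1 ++ existT D a (den m N a []) :: e2).
Proof.
  intros H HN. remember (G1 ++ a :: G2) as G eqn:EG. revert G1 e1 EG.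
  induction H; intros G1 e1 EG E1 E2; subst G; simpl.
  - assert (L : length e1 = length G1) by (subst G1; unfold types; now rewrite length_map).
    destruct (Nat.eqb_spec n (length G1)).
    + subst n. rewrite nth_error_app2, Nat.sub_diag in H by lia.
      simpl in H. injection H as <-.
      rewrite nth_error_app2, L, Nat.sub_diag by lia. simpl.
      rewrite coerce_same. now apply den_closed.
    + destruct (Nat.ltb_spec (length G1) n); simpl.
      * rewrite !nth_error_app2 by lia.
        replace (n - length e1) with (S (pred n - length e1)) by lia. reflexivity.
      * rewrite !nth_error_app1 by lia. reflexivity.
  - rewrite (shift_closed _ _ _ HN). extensionality x.
    apply (IHhas_type (s :: G1) (existT D s x :: e1)); simpl; congruence.
  - assert (T1 : has_type (types (e1 ++ e2)) (subst (length G1) N N0) s).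
    { rewrite types_app, E1, E2. now apply (has_type_subst _ _ a). }
    assert (T2 : has_type (types (e1 ++ existT D a (den m N a []) :: e2)) N0 s).
    { rewrite types_app; simpl; now rewrite E1, E2. }
    rewrite (tyof_has_type _ _ _ T1), (tyof_has_type _ _ _ T2).
    now rewrite IHhas_type1, IHhas_type2.
  - reflexivity.
Qed.

(** * Monotonicity in the fuel and soundness of reduction *)

Fixpoint le (s : ty) : D s -> D s -> Prop :=
  match s return D s -> D s -> Prop with
  | TN => fun x y => x = None \/ x = y
  | TArr a b => fun f g => forall x y, le a x y -> le b (f x) (g y)
  end.

Lemma le_bot s x : le s (bot s) x.
Proof. induction s; simpl; auto. Qed.

Lemma le_iter s f g m m' :
  le (TArr s s) f g -> m <= m' -> le s (iter m f (bot s)) (iter m' g (bot s)).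
Proof.
  intros H; revert m'; induction m; intros m' L; simpl; [apply le_bot|].
  destruct m' as [|m']; [lia|]. simpl. apply H, IHm. lia.
Qed.

Lemma le_const m m' c : m <= m' -> le (const_type c) (cden m c) (cden m' c).
Proof.
  intro L; destruct c; simpl; auto.
  - intros x y [->| ->]; auto.
  - intros x y [->| ->]; auto.
  - intros x y [->| ->]; auto. intros x1 y1 H1 x2 y2 H2. destruct y as [[|n]|]; auto.
  - intros f g H; now apply le_iter.
  - intros x y [->| ->]; auto.
Qed.

Inductive le_val : val -> val -> Prop :=
| le_val_intro s x y : le s x y -> le_val (existT D s x) (existT D s y).

Lemma types_le e e' : Forall2 le_val e e' -> types e = types e'.
Proof. induction 1; simpl; auto. destruct H. simpl; congruence. Qed.

(** [D] contains non-monotone functions, at which the logical relation [le] is not reflexive;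
    definable elements are related to themselves by induction on the term. *)
Lemma le_den m m' G t s e e' :
  m <= m' -> has_type G t s -> types e = G -> Forall2 le_val e e' ->
  le s (den m t s e) (den m' t s e').
Proof.
  intros L H; revert e e'; induction H; intros e e' E He; subst G.
  - simpl. revert e' He n H. induction e as [|v e IH]; intros e' He n H; [destruct n; discriminate|].
    inversion He as [|v1 v2 l1 l2 Hv Hl]; subst. destruct n; simpl in *.
    + destruct Hv. simpl in H. injection H as <-. now rewrite !coerce_same.
    + now apply IH.
  - intros x y Hxy. simpl. apply IHhas_type; simpl; auto. constructor; auto.
    now constructor.
  - rewrite !(den_app _ _ _ s); auto.
    + apply (IHhas_type1 e e' eq_refl He), IHhas_type2; auto.
    + now rewrite <- (types_le _ _ He).
  - rewrite !den_const. now apply le_const.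
Qed.

Lemma le_den_closed m m' t s :
  m <= m' -> has_type [] t s -> le s (den m t s []) (den m' t s []).
Proof. intros; apply (le_den m m' []); auto. Qed.

Lemma has_type_step t t' s : step t t' -> has_type [] t s -> has_type [] t' s.
Proof.
  intro H; revert s; induction H; intros r T;
    repeat match goal with
    | H : has_type _ (App _ _) _ |- _ => inversion H; clear H; subst
    | H : has_type _ (Lam _ _) _ |- _ => inversion H; clear H; subst
    | H : has_type _ (Const _) _ |- _ => inversion H; clear H; subst
    end; try (repeat econstructor; eauto; fail).
  - eapply (has_type_subst [] []); eauto.
  - eapply T_App; [eassumption|]. eapply T_App; [apply (T_Const [] (CY r))|assumption].
  - eapply T_App; [apply (T_Const [] CSuc)|auto].
  - eapply T_App; [apply (T_Const [] CPre)|auto].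
  - eapply T_App; [apply (T_Const [] CIfz)|auto].
Qed.

Lemma has_type_const_inv G c s : has_type G (Const c) s -> s = const_type c.
Proof. now inversion 1. Qed.

(** One unfolding costs one unit of fuel: [M (Y M)] with fuel [m] denotes [M] applied to the [m]-th
    iterate, which lies below the iterate [S m]. *)
Lemma le_step m t t' s :
  step t t' -> has_type [] t s -> le s (den m t' s []) (den (S m) t s []).
Proof.
  intro H; revert s; induction H; intros r T; inversion T as [| |? a ? ? ? T1 T2|]; subst.
  - inversion T1 as [|? ? ? ? H2| |]; subst.
    rewrite (den_app _ _ _ a) by exact T2. simpl.
    assert (E := den_subst m [] [] a M r N [] [] H2 T2 eq_refl eq_refl).
    simpl in E. rewrite E.
    apply (le_den m (S m) [a]); auto. constructor; auto.
    constructor. apply le_den_closed; auto.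
  - apply has_type_const_inv in T1; injection T1 as -> ->.
    rewrite (den_app _ _ _ TN) by exact T2. unfold num. simpl. rewrite ?(den_const _ (CNum _)).
    unfold coerce; simpl. auto.
  - apply has_type_const_inv in T1; injection T1 as -> ->.
    rewrite (den_app _ _ _ TN) by exact T2. unfold coerce; simpl. unfold coerce; simpl. auto.
  - apply has_type_const_inv in T1; injection T1 as -> ->.
    rewrite (den_app _ _ _ TN) by exact T2. unfold coerce; simpl. unfold coerce; simpl. auto.
  - apply has_type_const_inv in T1; injection T1 as -> ->.
    rewrite (den_app _ _ _ TN) by exact T2. simpl. rewrite ?(coerce_same TN).
    intros x y Hx x' y' Hx'. rewrite coerce_same. unfold coerce; simpl. auto.
  - apply has_type_const_inv in T1; injection T1 as -> ->.
    rewrite (den_app _ _ _ TN) by exact T2. simpl.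
    intros x y Hx x' y' Hx'. rewrite coerce_same. unfold coerce; simpl. auto.
  - apply has_type_const_inv in T1; injection T1 as -> ->.
    rewrite (den_app _ _ _ s) by exact T.
    rewrite !(den_app _ _ _ (TArr s s)) by exact T2.
    change (TArr (TArr s s) s) with (const_type (CY s)). rewrite !den_const.
    assert (HM := le_den_closed m (S m) M _ (Nat.le_succ_diag_r m) T2).
    simpl. apply HM, le_iter; auto.
  - apply has_type_const_inv in T1; injection T1 as -> ->.
    rewrite (den_app _ _ _ TN) by exact T2. unfold coerce; simpl. unfold coerce; simpl.
    rewrite H. auto.
  - rewrite !(den_app _ _ _ a) by exact T2.
    apply (IHstep _ T1), le_den_closed; auto.
  - apply has_type_const_inv in T1; injection T1 as -> ->.
    rewrite !(den_app _ _ _ TN) by eauto using has_type_step.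
    change (TArr TN TN) with (const_type CSuc). rewrite !den_const.
    exact (le_const m (S m) CSuc (Nat.le_succ_diag_r m) _ _ (IHstep TN T2)).
  - apply has_type_const_inv in T1; injection T1 as -> ->.
    rewrite !(den_app _ _ _ TN) by eauto using has_type_step.
    change (TArr TN TN) with (const_type CPre). rewrite !den_const.
    exact (le_const m (S m) CPre (Nat.le_succ_diag_r m) _ _ (IHstep TN T2)).
  - apply has_type_const_inv in T1; injection T1 as -> ->.
    rewrite !(den_app _ _ _ TN) by eauto using has_type_step.
    change (TArr TN (TArr TN (TArr TN TN))) with (const_type CIfz). rewrite !den_const.
    exact (le_const m (S m) CIfz (Nat.le_succ_diag_r m) _ _ (IHstep TN T2)).
Qed.

Lemma den_steps_num t n :
  steps t (num n) -> has_type [] t TN ->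
  exists m, forall m', m <= m' -> den m' t TN [] = Some n.
Proof.
  intro H. remember (num n) as u eqn:E. induction H; intro T; subst.
  - exists 0. intros. reflexivity.
  - destruct (IHsteps eq_refl (has_type_step _ _ _ H T)) as [m Hm].
    exists (S m). intros m' L. destruct m' as [|m']; [lia|].
    destruct (le_step m' _ _ _ H T) as [E|E]; rewrite Hm in E by lia; congruence.
Qed.

(** * Adequacy for oracle-free terms *)

(* The terms of [g] are meant to be closed, so they are not shifted under the [d] binders. *)
Fixpoint csub (d : nat) (g : list tm) (t : tm) : tm :=
  match t with
  | Var n => if n <? d then Var n else nth (n - d) g (Var n)
  | Lam s t => Lam s (csub (S d) g t)
  | App t u => App (csub d g t) (csub d g u)
  | Const c => Const c
  end.

Definition closed_tm (t : tm) (s : ty) : Prop := has_type [] t s.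

Lemma has_type_csub G1 G2 t s g :
  has_type (G1 ++ G2) t s -> Forall2 closed_tm g G2 ->
  has_type G1 (csub (length G1) g t) s.
Proof.
  intros H Hg. remember (G1 ++ G2) as G eqn:EG. revert G1 EG.
  induction H; intros G1 EG; subst G; simpl.
  - destruct (Nat.ltb_spec n (length G1)).
    + rewrite nth_error_app1 in H by lia. now constructor.
    + rewrite nth_error_app2 in H by lia.
      apply closed_weaken.
      revert H. generalize (n - length G1) as j. generalize (Var n) as v.
      induction Hg as [|u a g G2 Hu Hg IH]; intros v [|j] H; simpl in *; try discriminate.
      * injection H as <-; exact Hu.
      * eauto.
  - constructor. now apply (IHhas_type (s :: G1)).
  - econstructor; eauto.
  - constructor.
Qed.

Lemma subst_csub G1 a G2 t s g u :
  has_type (G1 ++ a :: G2) t s -> has_type [] u a -> Forall2 closed_tm g G2 ->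
  subst (length G1) u (csub (S (length G1)) g t) = csub (length G1) (u :: g) t.
Proof.
  intros H Hu Hg. remember (G1 ++ a :: G2) as G eqn:EG. revert G1 EG.
  induction H; intros G1 EG; subst G; simpl.
  - destruct (Nat.ltb_spec n (S (length G1))); simpl.
    + destruct (Nat.eqb_spec n (length G1)).
      * subst n. rewrite Nat.ltb_irrefl, Nat.sub_diag. reflexivity.
      * destruct (Nat.ltb_spec (length G1) n); [lia|].
        destruct (Nat.ltb_spec n (length G1)); [reflexivity|lia].
    + destruct (Nat.ltb_spec n (length G1)); [lia|].
      rewrite nth_error_app2 in H by lia.
      replace (n - length G1) with (S (n - S (length G1))) in H |- * by lia. simpl in H |- *.
      revert H. generalize (n - S (length G1)) as j. generalize (Var n) as v.
      induction Hg as [|v b g G2 Hv Hg IH]; intros v' [|j] H; simpl in *; try discriminate.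
      * now apply (subst_closed _ b).
      * eauto.
  - f_equal. rewrite (shift_closed _ _ _ Hu). now apply (IHhas_type (s :: G1)).
  - f_equal; auto.
  - reflexivity.
Qed.

Lemma csub_nil_closed t s d g : has_type [] t s -> csub d g t = t.
Proof.
  intro H. enough (K : forall G, has_type G t s -> forall d, length G <= d -> csub d g t = t)
    by (apply (K []); [exact H|simpl; lia]).
  clear. intros G H; induction H; intros d L; simpl.
  - assert (n < length G) by (apply nth_error_Some; congruence).
    destruct (Nat.ltb_spec n d); [reflexivity|lia].
  - f_equal. apply IHhas_type; simpl; lia.
  - f_equal; auto.
  - reflexivity.
Qed.

Lemma steps_trans t u v : steps t u -> steps u v -> steps t v.
Proof. induction 1; intros; auto. econstructor; eauto. Qed.

Lemma steps_one t u : step t u -> steps t u.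
Proof. intro; econstructor; eauto. constructor. Qed.

Lemma steps_cong f t u :
  (forall a b, step a b -> step (f a) (f b)) -> steps t u -> steps (f t) (f u).
Proof. intros Hf; induction 1; [constructor|econstructor; eauto]. Qed.

(** [None] imposes no condition, so [bot] is related to every term and the fixed point operators are
    handled by induction on the fuel. *)
Fixpoint adq (s : ty) : D s -> tm -> Prop :=
  match s return D s -> tm -> Prop with
  | TN => fun d t => forall n, d = Some n -> steps t (num n)
  | TArr a b => fun d t =>
      forall x u, has_type [] u a -> adq a x u -> adq b (d x) (App t u)
  end.

Lemma adq_expand s d t t' : steps t t' -> adq s d t' -> adq s d t.
Proof.
  revert d t t'; induction s; simpl; intros d t t' H A.
  - intros n E. eapply steps_trans; eauto.
  - intros x u Hu Ax. eapply IHs2; [|exact (A x u Hu Ax)].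
    apply (steps_cong (fun t => App t u)); auto. intros; now apply S_AppL.
Qed.

Lemma adq_bot s t : adq s (bot s) t.
Proof. revert t; induction s; simpl; intros; auto. discriminate. Qed.

Lemma adq_const m c : const_no_oracle c -> adq (const_type c) (cden m c) (Const c).
Proof.
  intro Hc; destruct c; simpl in *; try contradiction.
  - intros n' E; injection E as <-. constructor.
  - intros [n|] u Hu Hx n' E; [|discriminate]. injection E as <-.
    eapply steps_trans; [|apply steps_one, S_Suc].
    apply (steps_cong (fun t => App (Const CSuc) t)); auto. intros; now apply S_SucC.
  - intros [n|] u Hu Hx n' E; [|discriminate]. injection E as <-.
    eapply steps_trans; [apply (steps_cong (fun t => App (Const CPre) t))|].
    + intros; now apply S_PreC.
    + apply Hx; reflexivity.
    + destruct n; apply steps_one; constructor.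
  - intros x u Hu Hx y v Hv Hy z w Hw Hz n' E.
    destruct x as [n|]; [|discriminate].
    assert (H1 : steps (App (App (App (Const CIfz) u) v) w)
                       (App (App (App (Const CIfz) (num n)) v) w)).
    { apply (steps_cong (fun t => App (App (App (Const CIfz) t) v) w)); auto.
      intros; do 2 apply S_AppL. now apply S_IfzC. }
    eapply steps_trans; [exact H1|]. clear H1.
    destruct n.
    + eapply steps_step; [do 2 apply S_AppL; apply S_Ifz0|].
      eapply steps_step; [apply S_AppL; apply S_Beta|]. simpl.
      eapply steps_step; [apply S_Beta|]. rewrite (shift_closed _ _ _ Hv).
      rewrite (subst_closed _ _ _ _ Hv). auto.
    + eapply steps_step; [do 2 apply S_AppL; apply S_IfzS|].
      eapply steps_step; [apply S_AppL; apply S_Beta|]. simpl.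
      eapply steps_step; [apply S_Beta|]. simpl. auto.
  - intros f u Hu Hf.
    assert (T : has_type [] (App (Const (CY t)) u) t)
      by (eapply T_App; [apply (T_Const [] (CY t))|auto]).
    induction m; simpl.
    + apply adq_bot.
    + eapply adq_expand; [apply steps_one, S_Y|]. now apply Hf.
Qed.

Inductive adq_val : val -> tm -> Prop :=
| adq_val_intro s x t : has_type [] t s -> adq s x t -> adq_val (existT D s x) t.

Lemma adq_val_closed e g : Forall2 adq_val e g -> Forall2 closed_tm g (types e).
Proof. induction 1; simpl; constructor; auto. now destruct H. Qed.

Lemma adq_den m G t s e g :
  has_type G t s -> all_consts const_no_oracle t -> types e = G -> Forall2 adq_val e g ->
  adq s (den m t s e) (csub 0 g t).
Proof.
  intros H; revert e g; induction H; intros e g O E Hg; subst G.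
  - simpl. rewrite Nat.sub_0_r.
    clear O. generalize (Var n) as v. intro v. revert v n H.
    induction Hg as [|d u e g Hd Hg IH]; intros v [|n] H; simpl in *; try discriminate.
    + destruct Hd. simpl in H. injection H as <-. now rewrite coerce_same.
    + apply (IH v). exact H.
  - simpl. intros x u Hu Hx.
    eapply adq_expand; [apply steps_one, S_Beta|].
    assert (E := subst_csub [] s (types e) M t g u H Hu (adq_val_closed _ _ Hg)).
    simpl in E; rewrite E.
    apply IHhas_type; auto. constructor; auto. now constructor.
  - rewrite (den_app _ _ _ s) by auto. destruct O as [O1 O2].
    simpl. apply (IHhas_type1 e g O1 eq_refl Hg).
    + apply (has_type_csub [] (types e)); auto. now apply adq_val_closed.
    + apply IHhas_type2; auto.
  - rewrite den_const. now apply adq_const.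
Qed.

Lemma adequacy m t n :
  has_type [] t TN -> all_consts const_no_oracle t ->
  den m t TN [] = Some n -> steps t (num n).
Proof.
  intros T O E. rewrite <- (csub_nil_closed t TN 0 [] T).
  apply (adq_den m [] t TN [] []); auto.
Qed.

(** * Keys and the Kripke relation of one key *)

(* An assignment gives the secrets of a test: [r n 0] is the number [q_n] and [r n j]
   the bit [r_n^j] of the [n]-th key, for [n <= i]; [r (S i) 1] is the final answer. *)
Definition A : Type := nat -> nat -> nat.

Definition upd (r : A) (n j v : nat) : A :=
  fun n' j' => if (n' =? n) && (j' =? j) then v else r n' j'.

Lemma upd_same r n j v : upd r n j v n j = v.
Proof. unfold upd. now rewrite !Nat.eqb_refl. Qed.

Lemma upd_other r n j v n' j' : ~ (n' = n /\ j' = j) -> upd r n j v n' j' = r n' j'.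
Proof.
  intro H. unfold upd. destruct (Nat.eqb_spec n' n); destruct (Nat.eqb_spec j' j); simpl; auto.
  destruct H; auto.
Qed.

(** Outside a finite rectangle the bound 1 forces the value 0, so there are finitely many
    assignments. The range of [r n 0] grows with [i], in order to escape any bounded list of
    exceptional values. *)
Definition bd (p i n j : nat) : nat :=
  if (n <=? S i) && (j <=? S p) then match j with 0 => i | S _ => 2 end else 1.

Definition Ass (p i : nat) (r : A) : Prop := forall n j, r n j < bd p i n j.

Lemma Ass_upd p i r n j v : Ass p i r -> v < bd p i n j -> Ass p i (upd r n j v).
Proof.
  intros H L n' j'. unfold upd.
  destruct (Nat.eqb_spec n' n); destruct (Nat.eqb_spec j' j); simpl; subst; auto.
Qed.

Lemma bd_0 p i n : n <= S i -> bd p i n 0 = i.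
Proof. intro H. unfold bd. destruct (Nat.leb_spec n (S i)); [reflexivity|lia]. Qed.

Lemma bd_S p i n j : n <= S i -> j <= p -> bd p i n (S j) = 2.
Proof.
  intros H L. unfold bd. destruct (Nat.leb_spec n (S i)); [|lia].
  destruct (Nat.leb_spec (S j) (S p)); [reflexivity|lia].
Qed.

Definition fam (s : ty) : Type := A -> D s.

Definition fapp {a b : ty} (f : fam (TArr a b)) (y : fam a) : fam b := fun r => f r (y r).

Definition tc (c : A -> Prop) (x : fam TN) : Prop :=
  (forall r, c r -> x r <> None) -> forall r r', c r -> c r' -> x r = x r'.

Lemma tc_const c d : tc c (fun _ => d).
Proof. now intros ? ?. Qed.

Lemma tc_bind c x (phi : nat -> option nat) :
  tc c x -> tc c (fun r => match x r with Some n => phi n | None => None end).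
Proof.
  intros H T r r' Hr Hr'. rewrite (H) with (r := r) (r' := r'); auto.
  intros r0 H0 E. apply (T r0 H0). now rewrite E.
Qed.

Lemma tc_ifz c x y z :
  tc c x -> tc c y -> tc c z ->
  tc c (fun r => match x r with Some 0 => y r | Some (S _) => z r | None => None end).
Proof.
  intros Hx Hy Hz T r r' Hr Hr'.
  assert (E : forall r1 r2, c r1 -> c r2 -> x r1 = x r2).
  { apply Hx. intros r0 H0 E. apply (T r0 H0). now rewrite E. }
  rewrite (E r' r Hr' Hr). destruct (x r) as [[|v]|] eqn:Ex; auto.
  - apply Hy; auto. intros r0 H0. specialize (T r0 H0). now rewrite (E r0 r H0 Hr), Ex in T.
  - apply Hz; auto. intros r0 H0. specialize (T r0 H0). now rewrite (E r0 r H0 Hr), Ex in T.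
Qed.

Definition around (p i n : nat) (U : nat -> Prop) (r0 r : A) : Prop :=
  Ass p i r /\ forall n' j, ~ (n' = n /\ U j) -> r n' j = r0 n' j.

(* States of knowledge about the key [n].  In [WQ g] (resp. [WZ g], with [W2], [W3 E] for
   [g = 2, 3]) the secrets [r n j] with [j <= g] (resp. [j < g]) are unknown, while the
   objects [e_n^j] with [j = g - 1] or [j > g] (resp. [j >= g - 1]) are in scope; see
   [haskey].  [W1 r0] is the state [WQ 1] for the known secrets of [r0].  In [W3 E] the
   values listed by [E] are those secret numbers for which a number passed by value may
   happen to be the right answer. *)
Inductive world : Type :=
| W1 : A -> world
| W2 : world
| W3 : list (A -> nat) -> world
| WQ : nat -> world
| WZ : nat -> world.

(** A class of [W2] allows just two values of [r n 0], so that two values at which a number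
    misbehaves already yield a class on which it is total; see [W2_one_exception]. *)
Definition cls (p i n : nat) (w : world) (c : A -> Prop) : Prop :=
  match w with
  | W1 r0 => c = around p i n (fun j => j = 1) r0
  | W2 => exists r0 q1 q2, Ass p i r0 /\ q1 < i /\ q2 < i /\ q1 <> q2 /\
      c = fun r => around p i n (fun j => j < 2) r0 r /\ (r n 0 = q1 \/ r n 0 = q2)
  | W3 _ => exists r0, Ass p i r0 /\ c = around p i n (fun j => j < 3) r0
  | WQ g => exists r0, Ass p i r0 /\ c = around p i n (fun j => j < S g) r0
  | WZ g => exists r0, Ass p i r0 /\ c = around p i n (fun j => j < g) r0
  end.

Definition C (p i n : nat) (w : world) (x : fam TN) : Prop :=
  forall c, cls p i n w c -> tc c x.

Definition norm (n : nat) (r : A) : A := upd (upd r n 0 0) n 1 0.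

(* [r] is exceptional for [E] when its secret [r n 0] is one of the values listed by [E];
   these values may depend on the secrets other than [r n 0] and [r n 1]. *)
Definition exc (n : nat) (E : list (A -> nat)) (r : A) : Prop :=
  In (r n 0) (map (fun g => g (norm n r)) E).

(** A future never takes a key out of scope ([haskey_lew]); going from [WQ g] to [WQ (g - 1)], for
    instance, would lose [e_n^(g-1)]. The bound [length E' < i] keeps some value of [r n 0]
    unexceptional. *)
Definition fut (p i n : nat) (w w' : world) : Prop :=
  match w with
  | W1 _ | W2 => False
  | W3 E =>
      match w' with
      | W1 r => ~ exc n E r /\ Ass p i r
      | W2 => True
      | W3 E' => incl E E' /\ length E' < i
      | _ => False
      end
  | WQ g =>
      match w' with
      | W1 r => 3 <= g /\ Ass p i r
      | W2 => 2 <= g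
      | W3 E' => 3 <= g /\ length E' < i
      | WQ j => 2 <= j /\ j + 2 <= g
      | WZ j => 4 <= j <= g
      end
  | WZ g =>
      match w' with
      | W1 r => Ass p i r
      | W2 => True
      | W3 E' => length E' < i
      | WQ j => 2 <= j /\ j + 2 <= g
      | WZ j => 4 <= j < g
      end
  end.

Definition lew (p i n : nat) (w w' : world) : Prop := w = w' \/ fut p i n w w'.

Lemma exc_incl n E E' r : incl E E' -> exc n E r -> exc n E' r.
Proof. intros H. apply incl_map, H. Qed.

Lemma fut_trans p i n w1 w2 w3 : fut p i n w1 w2 -> fut p i n w2 w3 -> fut p i n w1 w3.
Proof.
  destruct w1, w2, w3; simpl; intros; try tauto; try lia.
  - destruct H, H0; split; auto. intro; apply H0. eapply exc_incl; eauto.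
  - destruct H, H0; split; auto. eapply incl_tran; eauto.
  - intuition lia.
  - intuition lia.
Qed.

Lemma lew_refl p i n w : lew p i n w w.
Proof. now left. Qed.

Lemma lew_trans p i n w1 w2 w3 : lew p i n w1 w2 -> lew p i n w2 w3 -> lew p i n w1 w3.
Proof.
  intros [->|H1] [->|H2]; unfold lew; auto. right; eapply fut_trans; eauto.
Qed.

Fixpoint K (p i n : nat) (w : world) (s : ty) : fam s -> Prop :=
  match s return fam s -> Prop with
  | TN => fun x => forall w', lew p i n w w' -> C p i n w' x
  | TArr a b => fun f => forall w', lew p i n w w' ->
      forall y, K p i n w' a y -> K p i n w' b (fapp f y)
  end.

Lemma K_mono p i n w w' s x : lew p i n w w' -> K p i n w s x -> K p i n w' s x.
Proof.
  intros L. destruct s; simpl; intros H w'' L'; apply H; eapply lew_trans; eauto.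
Qed.

Lemma K_app p i n w a b f y :
  K p i n w (TArr a b) f -> K p i n w a y -> K p i n w b (fapp f y).
Proof. intros H Hy. apply (H w (lew_refl _ _ _ _) y Hy). Qed.

Lemma K_base p i n w x : K p i n w TN x -> C p i n w x.
Proof. intro H; apply H, lew_refl. Qed.

Lemma K_bot p i n w s : K p i n w s (fun _ => bot s).
Proof.
  revert w; induction s; simpl; intros w w' L.
  - intros c _. apply tc_const.
  - intros y _. apply IHs2.
Qed.

Lemma K_TN_const p i n w d : K p i n w TN (fun _ => d).
Proof. intros w' _ c _. apply tc_const. Qed.

Lemma K_iter p i n w s f m :
  K p i n w (TArr s s) f -> K p i n w s (fun r => iter m (f r) (bot s)).
Proof.
  intro H. induction m; simpl; [apply K_bot|]. exact (K_app _ _ _ _ _ _ _ _ H IHm).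
Qed.

Lemma K_const p i n w m c : K p i n w (const_type c) (fun _ => cden m c).
Proof.
  destruct c; cbn [const_type].
  - apply K_TN_const.
  - intros w1 L1 x Hx w2 L2 c Hc. apply (tc_bind c x (fun n => Some (S n))).
    now apply (Hx w2).
  - intros w1 L1 x Hx w2 L2 c Hc. apply (tc_bind c x (fun n => Some (pred n))).
    now apply (Hx w2).
  - intros w1 L1 x Hx w2 L2 y Hy w3 L3 z Hz w4 L4 c Hc.
    apply (tc_ifz c x y z).
    + apply (Hx w4); auto. eapply lew_trans; [exact L2|]. eapply lew_trans; eauto.
    + apply (Hy w4); auto. eapply lew_trans; eauto.
    + now apply (Hz w4).
  - intros w1 L1 f Hf. now apply K_iter.
  - intros w1 L1 x Hx w2 L2 c Hc. apply (tc_bind c x o). now apply (Hx w2).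
Qed.

(** * Environments of families and the fundamental lemma of [K] *)

Notation fval I := {s : ty & I -> D s}.

Definition at_index {I : Type} (r : I) (v : fval I) : val :=
  existT D (projT1 v) (projT2 v r).

Definition ftypes {I : Type} (e : list (fval I)) : list ty := map (fun v => projT1 v) e.

Lemma types_at_index {I : Type} (r : I) e : types (map (at_index r) e) = ftypes e.
Proof. unfold types, ftypes. now rewrite map_map. Qed.

Lemma nth_error_ftypes {I : Type} (e : list (fval I)) n s :
  nth_error (ftypes e) n = Some s ->
  exists x : I -> D s, nth_error e n = Some (existT (fun s => I -> D s) s x).
Proof.
  unfold ftypes. rewrite nth_error_map.
  destruct (nth_error e n) as [[a x]|]; simpl; intro E; inversion E; subst. now exists x.
Qed.

Lemma den_var_at {I : Type} (r : I) m e n s x :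
  nth_error e n = Some (existT (fun s => I -> D s) s x) ->
  den m (Var n) s (map (at_index r) e) = x r.
Proof. intro H. simpl. rewrite nth_error_map, H. simpl. apply coerce_same. Qed.

Definition K_val (p i n : nat) (w : world) (v : fval A) : Prop :=
  K p i n w (projT1 v) (projT2 v).

(** Fixed point operators of every type are covered, being finite iterates at a given fuel; the
    bound on their level enters only with [MM]. *)
Lemma K_den p i n m G t s e w :
  has_type G t s -> ftypes e = G -> Forall (K_val p i n w) e ->
  K p i n w s (fun r => den m t s (map (at_index r) e)).
Proof.
  intro H; revert e w; induction H; intros e w E He; subst G.
  - destruct (nth_error_ftypes _ _ _ H) as [x Hx].
    replace (fun r => den m (Var n0) s (map (at_index r) e)) with x.
    + apply nth_error_In in Hx. rewrite Forall_forall in He. exact (He _ Hx).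
    + extensionality r. symmetry. now apply den_var_at.
  - intros w' L y Hy.
    apply (IHhas_type (existT (fun s => A -> D s) s y :: e) w' eq_refl).
    constructor; auto. eapply Forall_impl; [|exact He].
    intros v Hv. eapply K_mono; eauto.
  - replace (fun r => den m (App M N) t (map (at_index r) e)) with
      (fapp (fun r => den m M (TArr s t) (map (at_index r) e))
            (fun r => den m N s (map (at_index r) e))).
    + apply K_app; auto.
    + extensionality r. unfold fapp. rewrite (den_app _ _ _ s); auto.
      now rewrite types_at_index.
  - replace (fun r => den m (Const c) (const_type c) (map (at_index r) e))
      with (fun _ : A => cden m c).
    + apply K_const.
    + extensionality r. now rewrite den_const.
Qed.

Definition pub (j : nat) : D (pure j) :=
  match j return D (pure j) with
  | 0 => Some 0
  | S j' => fun _ => Some 0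
  end.

(* The key [e_n^j].  It answers [S n] to the public argument; on any other argument it
   answers its secret bit, provided that the argument behaves like [e_n^(j-1)]. *)
Fixpoint key (r : A) (n j : nat) {struct j} : D (pure j) :=
  match j return D (pure j) with
  | 0 => Some (S (r n 0))
  | S j' =>
      match j' return D (pure j') -> option nat with
      | 0 => fun x =>
          match x with
          | None => None
          | Some 0 => Some (S n)
          | Some (S q) => if q =? r n 0 then Some (r n 1) else None
          end
      | S j'' => fun x =>
          match x (pub j'') with
          | None => None
          | Some 0 => Some (S n)
          | Some (S _) =>
              match x (key r n j'') with
              | None => None
              | Some v => if v =? r n (S j'') then Some (r n (S (S j''))) else None
              end
          end
      end
  end.

Definition keyf (n j : nat) : fam (pure j) := fun r => key r n j.

(* The test functional: it maps a continuation and the key [n] to the value of the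
   continuation at the key [n + 1], along the list of keys [0, .., i]. *)
Definition walk (p i : nat) (r : A) : D (TArr (pure (S (S p))) (pure (S (S p)))) :=
  fun (G : D (pure (S (S p)))) (h : D (pure (S p))) =>
    match h (pub p) with
    | None => None
    | Some v =>
        if pred v <=? i then
          match h (key r (pred v) p) with
          | None => None
          | Some u =>
              if u =? r (pred v) (S p) then
                if pred v =? i then Some (r (S i) 1)
                else
                  match G (key r (S (pred v)) (S p)) with
                  | None => None
                  | Some z => if z =? r (S i) 1 then Some (r (S i) 1) else None
                  end
              else None
          end
        else None
    end.

Lemma K_pub p i n w j : K p i n w (pure j) (fun _ => pub j).
Proof.
  destruct j; simpl; [apply K_TN_const|]. intros w' L y Hy. apply K_TN_const.
Qed.

(** A key is strict in its probe of the argument, so totality of the key makes the probe total,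
    hence constant: the same branch is taken on the whole class. *)
Lemma key_total_cases c n j (x : fam (pure j)) :
  tc c (match j return fam (pure j) -> fam TN with
        | 0 => fun x => x | S j' => fun x => fapp x (fun _ => pub j') end x) ->
  (forall r, c r -> key r n (S j) (x r) <> None) ->
  (forall r, c r -> key r n (S j) (x r) = Some (S n)) \/
  (forall r, c r -> key r n (S j) (x r) = Some (r n (S j)) /\
     match j return fam (pure j) -> Prop with
     | 0 => fun x => x r = Some (S (r n 0))
     | S j' => fun x => x r (key r n j') = Some (r n (S j'))
     end x).
Proof.
  intros H T. destruct (classic (exists r, c r)) as [[r0 H0]|N];
    [|left; intros r Hr; destruct N; eauto].
  destruct j as [|j].
  - assert (E : forall r r', c r -> c r' -> x r = x r').
    { apply H. intros r Hr E. apply (T r Hr). simpl. now rewrite E. }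
    destruct (x r0) as [[|q]|] eqn:E0.
    + left. intros r Hr. simpl. now rewrite (E r r0 Hr H0), E0.
    + right. intros r Hr. specialize (T r Hr). simpl in *.
      rewrite (E r r0 Hr H0), E0 in *.
      destruct (Nat.eqb_spec q (r n 0)); subst; auto. congruence.
    + destruct (T r0 H0). simpl. now rewrite E0.
  - unfold fapp in H.
    assert (E : forall r r', c r -> c r' -> x r (pub j) = x r' (pub j)).
    { apply H. intros r Hr E. apply (T r Hr). simpl. now rewrite E. }
    destruct (x r0 (pub j)) as [[|q]|] eqn:E0.
    + left. intros r Hr. simpl. now rewrite (E r r0 Hr H0), E0.
    + right. intros r Hr. specialize (T r Hr). simpl in *.
      rewrite (E r r0 Hr H0), E0 in *.
      destruct (x r (key r n j)) as [v|]; [|congruence].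
      destruct (Nat.eqb_spec v (r n (S j))); subst; auto. congruence.
    + destruct (T r0 H0). simpl. now rewrite E0.
Qed.

Lemma K_probe p i n w j (x : fam (pure j)) :
  K p i n w (pure j) x ->
  K p i n w TN (match j return fam (pure j) -> fam TN with
        | 0 => fun x => x | S j' => fun x => fapp x (fun _ => pub j') end x).
Proof.
  destruct j; auto. intro H. apply K_app with (1 := H). apply K_pub.
Qed.

(* On a class where the answering bit is fixed, a key is harmless. *)
Lemma tc_key_fixed p i n w c n' j (x : fam (pure j)) :
  cls p i n w c -> K p i n w (pure j) x ->
  (forall r r', c r -> c r' -> r n' (S j) = r' n' (S j)) ->
  tc c (fapp (keyf n' (S j)) x).
Proof.
  intros Hc Hx F T r r' Hr Hr'.
  destruct (key_total_cases c n' j x) as [H|H].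
  - exact (K_base _ _ _ _ _ (K_probe _ _ _ _ _ _ Hx) c Hc).
  - exact T.
  - unfold fapp, keyf. now rewrite !H.
  - unfold fapp, keyf. destruct (H r Hr) as [-> _], (H r' Hr') as [-> _].
    now rewrite (F r r').
Qed.

Lemma cls_other_site p i n w c n' j r r' :
  cls p i n w c -> n' <> n -> c r -> c r' -> r n' j = r' n' j.
Proof.
  intros Hc Hn. assert (X : exists U r0, forall r, c r -> around p i n U r0 r).
  { destruct w; simpl in Hc.
    - subst c. eauto.
    - destruct Hc as (r0 & q1 & q2 & _ & _ & _ & _ & ->). do 2 eexists. intros r1 [H _]; exact H.
    - destruct Hc as (r0 & _ & ->). eauto.
    - destruct Hc as (r0 & _ & ->). eauto.
    - destruct Hc as (r0 & _ & ->). eauto. }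
  destruct X as (U & r0 & X). intros Hr Hr'.
  destruct (X r Hr) as [_ E], (X r' Hr') as [_ E']. rewrite E, E'; tauto.
Qed.

Lemma K_key_other p i n w n' j : n' <> n -> K p i n w (pure j) (keyf n' j).
Proof.
  intro Hn. destruct j as [|j].
  - intros w' L c Hc T r r' Hr Hr'. unfold keyf; simpl.
    now rewrite (cls_other_site _ _ _ _ _ _ 0 r r' Hc Hn).
  - intros w' L x Hx w'' L' c Hc.
    apply (tc_key_fixed p i n w''); auto.
    + eapply K_mono; eauto.
    + intros; eapply cls_other_site; eauto.
Qed.

Lemma walk_values p i r G h : walk p i r G h = None \/ walk p i r G h = Some (r (S i) 1).
Proof.
  unfold walk. destruct (h (pub p)); auto.
  destruct (_ <=? i); auto. destruct (h _); auto. destruct (_ =? _); auto.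
  destruct (_ =? i); auto. destruct (G _); auto. destruct (_ =? _); auto.
Qed.

(** Every defined value of the walk is the answer [r (S i) 1], and a world at a site [n <= i] fixes
    the secrets of the site [S i]. *)
Lemma K_walk p i n w : n <= i -> K p i n w _ (walk p i).
Proof.
  intros Hn w1 L1 G HG w2 L2 h Hh w3 L3 c Hc T r r' Hr Hr'.
  pose proof (T r Hr) as T1. pose proof (T r' Hr') as T2. unfold fapp in *.
  destruct (walk_values p i r (G r) (h r)) as [E|E]; [congruence|].
  destruct (walk_values p i r' (G r') (h r')) as [E'|E']; [congruence|].
  rewrite E, E'. f_equal. eapply cls_other_site; eauto. lia.
Qed.

Lemma fresh_below (l : list nat) i : length l < i -> exists q, q < i /\ ~ In q l.
Proof.
  intro L. apply NNPP. intro N.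
  assert (H : incl (seq 0 i) l).
  { intros q Hq. apply in_seq in Hq. apply NNPP. intro. apply N. exists q. split; [lia|auto]. }
  apply NoDup_incl_length in H; [|apply seq_NoDup]. rewrite length_seq in H. lia.
Qed.

Lemma around_upd p i n (U : nat -> Prop) r0 r j v :
  around p i n U r0 r -> U j -> v < bd p i n j -> around p i n U r0 (upd r n j v).
Proof.
  intros [H1 H2] Hj L. split.
  - now apply Ass_upd.
  - intros n' j' N. rewrite upd_other; auto. intros [-> ->]. tauto.
Qed.

Lemma around_self p i n (U : nat -> Prop) r0 : Ass p i r0 -> around p i n U r0 r0.
Proof. split; auto. Qed.

Lemma around_sub p i n (U V : nat -> Prop) r0 r1 r :
  around p i n V r0 r1 -> (forall j, U j -> V j) -> around p i n U r1 r -> around p i n V r0 r.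
Proof.
  intros [H1 H2] S [H3 H4]. split; auto. intros n' j N. rewrite H4, H2; auto.
  intros [-> ?]. apply N; auto.
Qed.

Lemma bits_vary p i n (U : nat -> Prop) r0 (y : fam TN) m :
  n <= i -> m <= p -> Ass p i r0 -> U (S m) ->
  tc (around p i n U r0) y ->
  (forall r, around p i n U r0 r -> y r = Some (r n (S m))) -> False.
Proof.
  intros Hn Hm H0 Um H E.
  assert (X : forall v, v < 2 -> around p i n U r0 (upd r0 n (S m) v)).
  { intros v Hv. apply around_upd; auto. now apply around_self. rewrite bd_S; lia. }
  assert (Y := H (fun r Hr => ltac:(rewrite (E r Hr); discriminate)) _ _
                 (X 0 ltac:(lia)) (X 1 ltac:(lia))).
  rewrite !E, !upd_same in Y by (apply X; lia). discriminate.
Qed.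

Lemma norm_upd n r v : norm n (upd r n 0 v) = norm n r.
Proof.
  extensionality n'. extensionality j. unfold norm, upd.
  destruct (Nat.eqb_spec n' n); destruct (Nat.eqb_spec j 1); destruct (Nat.eqb_spec j 0); auto.
Qed.

Definition haskey (p i j : nat) (w : world) : Prop :=
  match w with
  | W1 _ => j <> 1
  | W2 => 1 <= j
  | W3 E => 2 <= j /\ length E < i
  | WQ g => 2 <= g <= S p /\ (S j = g \/ S g <= j)
  | WZ g => 4 <= g <= S (S p) /\ g <= S j
  end.

Lemma haskey_lew p i n j w w' : lew p i n w w' -> haskey p i j w -> haskey p i j w'.
Proof.
  intros [->|H]; auto. destruct w, w'; simpl in *; intuition lia.
Qed.

(** [W1] knows [r n 0], so [e_n^0] satisfies [K] there, and [x] applied to it cannot follow the one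
    secret that varies. *)
Lemma W1_no_pass p i n r1 (x : fam (pure 1)) :
  n <= i -> Ass p i r1 -> K p i n (W1 r1) (pure 1) x ->
  (forall r, around p i n (fun j => j = 1) r1 r -> x r (key r n 0) = Some (r n 1)) -> False.
Proof.
  intros Hn H1 Hx E.
  apply (bits_vary p i n (fun j => j = 1) r1 (fapp x (keyf n 0)) 0); auto; [lia|].
  apply (K_base p i n (W1 r1)); [|reflexivity].
  apply (K_app _ _ _ _ _ _ _ _ Hx).
  intros w' [<-|[]] c Hc T r r' Hr Hr'. simpl in Hc. subst c. unfold keyf; simpl.
  destruct Hr as [_ Hr], Hr' as [_ Hr']. rewrite Hr, Hr'; auto; lia.
Qed.

(** Suppose that [e_n^(j+1)] answers with its bit. Either this bit is fixed on the class, or the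
    argument has imitated [e_n^j]. For [j >= 2] this means that it answers [e_n^(j-1)] with [r n j],
    which is impossible in the future [WQ j], where [e_n^(j-1)] is in scope by induction and [r n j]
    is unknown. *)
Lemma K_key p i n j w :
  2 <= i -> n <= i -> j <= S p -> haskey p i j w -> K p i n w (pure j) (keyf n j).
Proof.
  intros Hi Hn. revert w. induction j as [j IH] using lt_wf_ind. intros w Hj Hk.
  destruct j as [|j].
  - destruct w; simpl in Hk; try lia.
    intros w' [<-|[]] c Hc T r r' Hr Hr'. simpl in Hc. subst c. unfold keyf; simpl.
    destruct Hr as [_ Hr], Hr' as [_ Hr']. rewrite Hr, Hr'; auto; lia.
  - intros w1 L1 x Hx w2 L2 c Hc T r r' Hr Hr'.
    apply (haskey_lew _ _ _ _ _ _ L1) in Hk. apply (haskey_lew _ _ _ _ _ _ L2) in Hk.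
    apply (K_mono _ _ _ _ _ _ _ L2) in Hx. clear w w1 L1 L2.
    destruct (key_total_cases c n j x) as [H|H].
    { exact (K_base _ _ _ _ _ (K_probe _ _ _ _ _ _ Hx) c Hc). }
    { exact T. }
    { unfold fapp, keyf. now rewrite !H. }
    enough (F : r n (S j) = r' n (S j)).
    { unfold fapp, keyf. destruct (H r Hr) as [-> _], (H r' Hr') as [-> _]. now rewrite F. }
    assert (fixed : forall U r0, c = around p i n U r0 -> ~ U (S j) -> r n (S j) = r' n (S j)).
    { intros U r0 -> N. destruct Hr as [_ Hr], Hr' as [_ Hr']. rewrite Hr, Hr'; tauto. }
    (* The class leaves all secrets [r n j'] with [j' <= j] open, and the argument imitates [e_n^j].
       For [j = 0] it is a constant number facing a varying [r n 0]; for [j = 1] the secret number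
       is first fixed to [q]. *)
    assert (low : forall V r0, Ass p i r0 -> c = around p i n V r0 ->
              (forall j', j' < S j -> V j') ->
              (j = 1 -> exists q, q < i /\ K p i n (W1 (upd r0 n 0 q)) (pure j) x) ->
              (2 <= j -> K p i n (WQ j) (pure j) x) ->
              tc c (match j return fam (pure j) -> fam TN with
                | 0 => fun x => x | S j' => fun x => fapp x (fun _ => pub j') end x) ->
              False).
    { intros V r0 H0 -> HV C1 C2 C0.
      assert (H0' : around p i n V r0 r0) by now apply around_self.
      destruct j as [|[|j]].
      - assert (X : forall v, v < i -> around p i n V r0 (upd r0 n 0 v)).
        { intros v Hv. apply around_upd; auto. rewrite bd_0; lia. }
        assert (Y := C0 (fun r Hr => ltac:(rewrite (proj2 (H r Hr)); discriminate)) _ _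
                 (X 0 ltac:(lia)) (X 1 ltac:(lia))).
        rewrite (proj2 (H _ (X 0 ltac:(lia)))), (proj2 (H _ (X 1 ltac:(lia)))), !upd_same in Y.
        discriminate.
      - destruct (C1 eq_refl) as (q & Hq & C1').
        assert (X : around p i n V r0 (upd r0 n 0 q)).
        { apply around_upd; auto. rewrite bd_0; lia. }
        apply (W1_no_pass p i n (upd r0 n 0 q) x); auto.
        + apply X.
        + intros r2 H2. apply (H r2).
          apply (around_sub p i n (fun j => j = 1) V r0 (upd r0 n 0 q)); auto.
          intros; apply HV; lia.
      - apply (bits_vary p i n (fun j' => j' < S (S (S j))) r0 (fapp x (keyf n (S j))) (S j));
          auto; [lia| |].
        + apply (K_base p i n (WQ (S (S j)))); [|simpl; eauto].
          assert (C2' := C2 ltac:(lia)).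
          apply (K_app _ _ _ _ _ _ _ _ C2').
          apply (IH (S j)); [lia|lia|]. simpl. lia.
        + intros r2 H2. apply (H r2).
          apply (around_sub p i n (fun j' => j' < S (S (S j))) V r0 r0); auto. }
    assert (C0 := K_base _ _ _ _ _ (K_probe _ _ _ _ _ _ Hx) c Hc).
    destruct w2 as [r0| |E|g|g]; simpl in Hc.
    + apply (fixed _ _ Hc). exact Hk.
    + destruct Hc as (r0 & q1 & q2 & H0 & Q1 & Q2 & N & ->).
      destruct j as [|j].
      * exfalso.
        assert (X : forall v, v = q1 \/ v = q2 ->
          around p i n (fun j => j < 2) r0 (upd r0 n 0 v) /\
          (upd r0 n 0 v n 0 = q1 \/ upd r0 n 0 v n 0 = q2)).
        { intros v Hv. split; [|rewrite upd_same; lia].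
          apply around_upd; [now apply around_self|lia|]. rewrite bd_0; lia. }
        assert (Y := C0 (fun r Hr => ltac:(rewrite (proj2 (H r Hr)); discriminate)) _ _
                 (X q1 ltac:(lia)) (X q2 ltac:(lia))).
        rewrite (proj2 (H _ (X q1 ltac:(lia)))), (proj2 (H _ (X q2 ltac:(lia)))), !upd_same in Y.
        congruence.
      * destruct Hr as [[_ Hr] _], Hr' as [[_ Hr'] _]. rewrite Hr, Hr'; lia.
    + destruct Hc as (r0 & H0 & Ec). destruct Hk as [Hj2 HE].
      destruct (Nat.eq_dec j 1) as [->|]; [exfalso|apply (fixed _ _ Ec); lia].
      apply (low _ _ H0 Ec); [intros; lia| |lia|exact C0].
      intros _.
      (* Fewer than [i] exceptional values leave an unexceptional [q], so that [W1] becomes a future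
         of [W3 E]. *)
      destruct (fresh_below (map (fun g => g (norm n r0)) E) i) as (q & Hq & N);
        [now rewrite length_map|].
      exists q. split; auto. eapply K_mono; [|exact Hx]. right. simpl. split.
      * unfold exc. now rewrite norm_upd, upd_same.
      * apply Ass_upd; auto. rewrite bd_0; lia.
    + destruct Hc as (r0 & H0 & Ec). destruct Hk as [Hg Hk].
      destruct Hk as [Hk|Hk]; [exfalso|apply (fixed _ _ Ec); lia].
      apply (low _ _ H0 Ec); [intros; lia| | |exact C0].
      * intros ->. exists 0. split; [lia|]. eapply K_mono; [|exact Hx]. right. simpl.
        split; [lia|]. apply Ass_upd; auto. rewrite bd_0; lia.
      * intro J. eapply K_mono; [|exact Hx]. right. simpl. lia.
    + destruct Hc as (r0 & H0 & Ec). destruct Hk as [Hg Hk].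
      destruct (Nat.eq_dec g (S (S j))) as [Eg|]; [exfalso|apply (fixed _ _ Ec); lia].
      apply (low _ _ H0 Ec); [intros; lia|lia| |exact C0].
      intro J. eapply K_mono; [|exact Hx]. right. simpl. lia.
Qed.

(* A number computed with [e_n^1] in scope but without [r n 0] depends on a lucky guess of
   [r n 0]: it can betray [r n 1] for one value of [r n 0] only. *)
Lemma W2_one_exception p i n (y : fam TN) :
  n <= i -> C p i n W2 y ->
  exists g : A -> nat, forall r, Ass p i r -> ~ exc n [g] r -> C p i n (W1 r) y.
Proof.
  intros Hn H.
  set (bad := fun r q => q < i /\ ~ C p i n (W1 (upd r n 0 q)) y).
  (* The chosen bad value is read by [exc] at [norm n r], hence does not depend on [r n 0] and
     [r n 1]. *)
  exists (fun r => epsilon (inhabits 0) (bad r)).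
  intros r Hr N. apply NNPP. intro B. apply N. unfold exc. simpl. left.
  set (r1 := norm n r).
  assert (B1 : bad r1 (r n 0)).
  { split; [specialize (Hr n 0); rewrite bd_0 in Hr; lia|].
    intro X. apply B. intros c Hc T. simpl in Hc. subst c.
    assert (forall r', around p i n (fun j => j = 1) r r' <->
              around p i n (fun j => j = 1) (upd r1 n 0 (r n 0)) r') as Eq.
    { intro r'. unfold around. apply and_iff_compat_l.
      assert (F : forall n' j, ~ (n' = n /\ j = 1) -> upd r1 n 0 (r n 0) n' j = r n' j).
      { intros n' j Nj. unfold r1, norm, upd.
        destruct (Nat.eqb_spec n' n); destruct (Nat.eqb_spec j 0); destruct (Nat.eqb_spec j 1);
          simpl; subst; auto; lia. }
      split; intros Y n' j Nj; rewrite Y by auto; [symmetry|]; now apply F. }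
    intros r2 r3 H2 H3.
    apply (X _ eq_refl); [intros r' Hr'; apply T; now apply Eq| |]; now apply Eq. }
  assert (B2 := epsilon_spec (inhabits 0) (bad r1) (ex_intro _ _ B1)).
  set (q2 := epsilon (inhabits 0) (bad r1)) in *. fold r1.
  apply NNPP. intro Nq.
  destruct B1 as [Q1 B1], B2 as [Q2 B2].
  assert (A1 : Ass p i r1).
  { unfold r1, norm. apply Ass_upd; [apply Ass_upd; auto; rewrite bd_0; lia|].
    rewrite bd_S; lia. }
  assert (sub : forall q r', q < i -> around p i n (fun j => j = 1) (upd r1 n 0 q) r' ->
            around p i n (fun j => j < 2) r1 r' /\ r' n 0 = q).
  { intros q r' Hq [X1 X2]. split.
    - split; auto. intros n' j Nj. rewrite X2 by lia. apply upd_other. lia.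
    - rewrite X2 by lia. apply upd_same. }
  assert (tot : forall q, q < i -> ~ C p i n (W1 (upd r1 n 0 q)) y ->
            forall r', around p i n (fun j => j < 2) r1 r' -> r' n 0 = q -> y r' <> None).
  { intros q Hq X r' X1 X2 E. apply X. intros c Hc. simpl in Hc. subst c. intro T. exfalso.
    apply (T r'); auto. destruct X1 as [X1 X3]. split; auto.
    intros n' j Nj. destruct (classic (n' = n /\ j = 0)) as [[-> ->]|].
    - now rewrite upd_same.
    - rewrite upd_other by auto. apply X3. lia. }
  apply B1. intros c Hc _ ra rb Ha Hb. simpl in Hc. subst c.
  (* A failure of [tc] includes totality; so [y] is total on the class with the two bad values,
     hence constant there, and neither value is bad. *)
  apply (H (fun r' => around p i n (fun j => j < 2) r1 r' /\ (r' n 0 = r n 0 \/ r' n 0 = q2))).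
  - exists r1, (r n 0), q2. repeat split; auto.
  - intros r' [X [Y|Y]].
    + eapply (tot (r n 0)); eauto.
    + eapply (tot q2); eauto.
  - destruct (sub _ _ Q1 Ha). auto.
  - destruct (sub _ _ Q1 Hb). auto.
Qed.

(** * The boundary between adjacent scopes *)

Fixpoint tsize (s : ty) : nat :=
  match s with
  | TN => 1
  | TArr a b => tsize a + tsize b
  end.

Lemma tsize_pos s : 1 <= tsize s.
Proof. induction s; simpl; lia. Qed.

Lemma lv_zero s : lv s = 0 -> s = TN.
Proof. destruct s; simpl; auto. lia. Qed.

Lemma boundary_low p i n s E x :
  n <= i -> lv s <= 1 -> length E + tsize s <= i ->
  K p i n (W3 E) s x -> K p i n (WQ 2) s x.
Proof.
  intros Hn. revert E x. induction s as [|a _ b IH]; intros E x Hs HE H.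
  - intros w' [<-|L].
    + exact (K_base _ _ _ _ _ H).
    + destruct w'; simpl in L; try lia. apply H. right. simpl. auto.
  - simpl in Hs, HE. assert (Ea : a = TN) by (apply lv_zero; lia). subst a. simpl in HE. pose proof (tsize_pos b).
    intros w' [<-|L] y Hy.
    + destruct (W2_one_exception p i n y Hn) as [g Hg].
      { apply Hy. right. simpl; lia. }
      apply (IH (g :: E)); [lia|simpl; lia|].
      apply H.
      * right. simpl. split; [|lia]. intros z Hz; now right.
      * intros w' [<-|L].
        -- exact (K_base _ _ _ _ _ Hy).
        -- destruct w'; simpl in L; try lia.
           ++ apply Hg; [tauto|]. intro X. apply (proj1 L). eapply exc_incl; [|exact X].
              intros z [->|[]]. now left.
           ++ apply Hy. right. simpl; lia.
           ++ exact (K_base _ _ _ _ _ Hy).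
    + destruct w'; simpl in L; try lia. apply H; auto. right; simpl; auto.
Qed.

Definition Zw (g : nat) : world :=
  match g with
  | 0 | 1 | 2 => W2
  | 3 => W3 []
  | _ => WZ g
  end.

(* Objects of low level made with [e_n^(g+2)] in scope are harmless in a scope that has
   [e_n^(g+1)] instead: the two keys cannot interact through types of level [<= g + 1]. *)
Lemma boundary p i n g s x :
  n <= i -> lv s <= S g -> tsize s <= i ->
  K p i n (Zw (S (S (S g)))) s x -> K p i n (WQ (S (S g))) s x.
Proof.
  intros Hn. revert s x. induction g as [|g IHg].
  - intros s x H1 H2. apply boundary_low; auto.
  - set (w1 := WZ (S (S (S (S g))))). set (w2 := WQ (S (S (S g)))).
    change (Zw (S (S (S (S g))))) with w1.
    assert (F2 : forall w', fut p i n w2 w' -> fut p i n w1 w').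
    { intros w' L. destruct w'; simpl in *; intuition lia. }
    assert (F1 : forall w', fut p i n w1 w' -> w' = WQ (S (S g)) \/ fut p i n w2 w').
    { intros w' L. destruct w' as [r| |E|j|j]; simpl in *.
      - right; split; [lia|auto].
      - right; lia.
      - right; split; [lia|auto].
      - destruct (Nat.eq_dec j (S (S g))); subst; [auto|right; lia].
      - right; lia. }
    (* Passing to an argument reverses the direction and lowers the level by one, so both directions
       are proved together, at levels that differ by one. *)
    enough (X : forall s, tsize s <= i ->
      (lv s <= S (S g) -> forall x, K p i n w1 s x -> K p i n w2 s x) /\
      (lv s <= S g -> forall x, K p i n w2 s x -> K p i n w1 s x)).
    { intros s x H1 H2. now apply X. }
    (* This serves the only future of [w1] that [w2] lacks: [Zw (S (S (S g)))] is a future of [w2],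
       and the induction hypothesis leads from there to [WQ (S (S g))]. *)
    assert (down : forall s x, lv s <= S g -> tsize s <= i ->
              K p i n w2 s x -> K p i n (WQ (S (S g))) s x).
    { intros s x H1 H2 H. apply IHg; auto. eapply K_mono; [|exact H].
      right. pose proof (tsize_pos s). destruct g; simpl; lia. }
    induction s as [|a IHa b IHb]; intro Hs.
    + simpl in Hs. split; intros Hl x H w' [<-|L].
      * exact (K_base _ _ _ _ _ H).
      * apply H. right. auto.
      * exact (K_base _ _ _ _ _ H).
      * destruct (F1 _ L) as [->|L'].
        -- apply (K_base p i n (WQ (S (S g)))). apply (down TN); auto; simpl; lia.
        -- apply H. now right.
    + simpl in Hs. pose proof (tsize_pos a) as Pa. pose proof (tsize_pos b) as Pb.
      destruct IHa as [IHa1 IHa2]; [lia|]. destruct IHb as [IHb1 IHb2]; [lia|].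
      split; intros Hl x H; simpl in Hl.
      * intros w' [<-|L] y Hy.
        -- apply IHb1; [lia|]. apply (H w1 (lew_refl _ _ _ _)). apply IHa2; auto. lia.
        -- apply H; auto. right. auto.
      * intros w' [<-|L] y Hy.
        -- apply IHb2; [lia|]. apply (H w2 (lew_refl _ _ _ _)). apply IHa1; auto. lia.
        -- destruct (F1 _ L) as [->|L'].
           ++ apply (K_app _ _ _ _ a b); auto.
           ++ apply H; auto. now right.
Qed.

(** * The relation for the whole run *)

(* The worlds that constrain the site [n] when the keys [0, .., a] are in scope. *)
Definition scope_world (p i a : nat) (E : nat -> list (A -> nat)) (n : nat) (w : world) : Prop :=
  w = Zw (S (S p)) \/
  (a < n /\ match p with
            | 0 => exists r, Ass p i r /\ ~ exc n (E n) r /\ w = W1 r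
            | S _ => w = WQ (S p)
            end).

Definition GC (p i a : nat) (E : nat -> list (A -> nat)) (s : ty) (x : fam s) : Prop :=
  forall n w, n <= i -> scope_world p i a E n w -> K p i n w s x.

Lemma GC_app p i a E b c f y :
  GC p i a E (TArr b c) f -> GC p i a E b y -> GC p i a E c (fapp f y).
Proof. intros H1 H2 n w Hn Hw. apply (K_app p i n w b c); auto. Qed.

Lemma GC_bot p i a E s : GC p i a E s (fun _ => bot s).
Proof. intros n w _ _. apply K_bot. Qed.

Lemma GC_const p i a E m c : GC p i a E (const_type c) (fun _ => cden m c).
Proof. intros n w _ _. apply K_const. Qed.

Lemma GC_mono p i a a' E E' s x :
  a <= a' -> (forall n, incl (E n) (E' n)) -> GC p i a E s x -> GC p i a' E' s x.
Proof.
  intros La LE H n w Hn [Hw|[Ha Hw]]; apply H; auto; [now left|right].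
  split; [lia|]. destruct p; auto. destruct Hw as (r & H1 & H2 & H3). exists r.
  repeat split; auto. intro X; apply H2. eapply exc_incl; [apply LE|exact X].
Qed.

Lemma GC_den p i a E m G t s e :
  has_type G t s -> ftypes e = G ->
  Forall (fun v : fval A => GC p i a E (projT1 v) (projT2 v)) e ->
  GC p i a E s (fun r => den m t s (map (at_index r) e)).
Proof.
  intros T Ee He n w Hn Hw. apply (K_den p i n m G); auto.
  eapply Forall_impl; [|exact He]. intros v Hv. apply Hv; auto.
Qed.

Definition all_in_scope (p i : nat) (s : ty) (x : fam s) : Prop :=
  forall n, n <= i -> K p i n (Zw (S (S p))) s x.

Lemma GC_all_in_scope p i a E s x : GC p i a E s x -> all_in_scope p i s x.
Proof. intros H n Hn. apply H; auto. now left. Qed.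

(* Up to level [k - 1] having a key in scope makes no difference; for [k = 1] this holds
   with one exceptional value of each secret number. *)
Lemma GC_of_all_in_scope p i s x E :
  lv s <= p -> tsize s <= i -> all_in_scope p i s x ->
  exists g : nat -> A -> nat, forall a, GC p i a (fun n => g n :: E n) s x.
Proof.
  intros Hl Hs H. destruct p as [|p].
  - assert (Es : s = TN) by (apply lv_zero; lia). subst s.
    set (Q := fun n (g : A -> nat) =>
                forall r, Ass 0 i r -> ~ exc n [g] r -> C 0 i n (W1 r) x).
    exists (fun n => epsilon (inhabits (fun _ : A => 0)) (Q n)).
    intros a n w Hn [->|[Ha (r & Hr & N & ->)]]; [now apply H|].
    assert (HQ : Q n (epsilon (inhabits (fun _ : A => 0)) (Q n))).
    { apply epsilon_spec. apply W2_one_exception; auto.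
      apply (K_base 0 i n W2). now apply H. }
    intros w' [<-|[]]. apply HQ; auto. intro X; apply N. eapply exc_incl; [|exact X].
    intros z [->|[]]. now left.
  - exists (fun _ _ => 0). intros a n w Hn [->|[Ha ->]]; [now apply H|].
    apply boundary; auto.
Qed.

Lemma Ass_zero p i : 1 <= i -> Ass p i (fun _ _ => 0).
Proof.
  intros Hi n j. unfold bd. destruct (_ && _); [destruct j|]; lia.
Qed.

(** Beyond the scope [a] the site may be viewed at [WQ (S p)], or for [p = 0] at [W1] with an
    unexceptional number. There [e_n^p] is in scope and [r n (S p)] is unknown, so [h] cannot give
    this bit. *)
Lemma out_of_scope_no_pass p i a E n (h : fam (pure (S p))) :
  2 <= i -> n <= i -> a < n -> length (E n) < i -> GC p i a E (pure (S p)) h ->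
  (forall r, Ass p i r -> h r (key r n p) = Some (r n (S p))) -> False.
Proof.
  intros Hi Hn Ha HE H X. assert (Z := Ass_zero p i ltac:(lia)). destruct p as [|p].
  - destruct (fresh_below (map (fun g => g (norm n (fun _ _ => 0))) (E n)) i) as (q & Hq & N);
      [now rewrite length_map|].
    assert (A1 : Ass 0 i (upd (fun _ _ => 0) n 0 q)) by (apply Ass_upd; auto; rewrite bd_0; lia).
    apply (W1_no_pass 0 i n (upd (fun _ _ => 0) n 0 q) h); auto.
    + apply H; auto. right. split; auto. eexists. repeat split; eauto.
      unfold exc. now rewrite norm_upd, upd_same.
    + intros r [Hr _]. now apply X.
  - apply (bits_vary (S p) i n (fun j => j < S (S (S p))) (fun _ _ => 0)
             (fapp h (keyf n (S p))) (S p)); auto.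
    + apply (K_base (S p) i n (WQ (S (S p)))); [|simpl; eauto].
      apply (K_app _ _ _ _ (pure (S p)) TN).
      * apply H; auto. right; auto.
      * apply K_key; auto. simpl. lia.
    + intros r [Hr _]. now apply X.
Qed.

(** Totality is tested on all assignments at once and there are no worlds in the arrow clause, so
    this is a condition at a single [i]. *)
Fixpoint L (p i : nat) (s : ty) : fam s -> Prop :=
  match s return fam s -> Prop with
  | TN => fun x => tc (Ass p i) x /\ all_in_scope p i TN x
  | TArr a b => fun f =>
      (forall y, L p i a y -> L p i b (fapp f y)) /\ all_in_scope p i (TArr a b) f
  end.

Lemma L_all_in_scope p i s x : L p i s x -> all_in_scope p i s x.
Proof. destruct s; intros []; auto. Qed.

Lemma L_bot p i s : L p i s (fun _ => bot s).
Proof.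
  induction s; simpl; split.
  - apply tc_const.
  - intros n _. apply K_bot.
  - intros y _. exact IHs2.
  - intros n _. apply (K_bot p i n _ (TArr s1 s2)).
Qed.


(** * Properties for almost all [i], and the relation [MM] *)

Definition ev (P : nat -> Prop) : Prop := exists N, forall i, N <= i -> P i.

Lemma ev_imp (P Q : nat -> Prop) : (forall i, P i -> Q i) -> ev P -> ev Q.
Proof. intros H [N HN]. exists N. auto. Qed.

Lemma ev_and (P Q : nat -> Prop) : ev P -> ev Q -> ev (fun i => P i /\ Q i).
Proof.
  intros [N HN] [N' HN']. exists (N + N'). intros i Hi. split; [apply HN|apply HN']; lia.
Qed.

Lemma ev_ge c : ev (fun i => c <= i).
Proof. now exists c. Qed.

Lemma ev_all (P : nat -> Prop) : (forall i, P i) -> ev P.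
Proof. intro H. exists 0. auto. Qed.

Lemma ev_below c (P : nat -> nat -> Prop) :
  (forall n, n <= c -> ev (P n)) -> ev (fun i => forall n, n <= c -> P n i).
Proof.
  induction c; intro H.
  - eapply ev_imp; [|apply (H 0); auto]. intros i Hi n Hn. now replace n with 0 by lia.
  - eapply ev_imp; [|apply ev_and; [apply IHc; intros; apply H; lia|apply (H (S c)); auto]].
    intros i [H1 H2] n Hn. destruct (Nat.eq_dec n (S c)) as [->|]; auto. apply H1. lia.
Qed.

Lemma ev_Forall {X : Type} (P : nat -> X -> Prop) l :
  Forall (fun v => ev (fun i => P i v)) l -> ev (fun i => Forall (P i) l).
Proof.
  induction 1; [apply ev_all; constructor|].
  eapply ev_imp; [|apply ev_and; [exact H|exact IHForall]]. intros i []; now constructor.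
Qed.

Definition mfam (s : ty) : Type := nat -> fam s.

Definition exset : Type := nat -> nat -> list (A -> nat).

Definition bounded (E : exset) : Prop := exists c, forall i n, length (E i n) <= c.

Definition inclE (E E' : exset) : Prop := forall i n, incl (E i n) (E' i n).

Lemma inclE_refl E : inclE E E.
Proof. intros i n; apply incl_refl. Qed.

Lemma inclE_trans E1 E2 E3 : inclE E1 E2 -> inclE E2 E3 -> inclE E1 E3.
Proof. intros H1 H2 i n; eapply incl_tran; eauto. Qed.

Definition low (p i a : nat) (E : nat -> list (A -> nat)) (s : ty) (x : fam s) : Prop :=
  L p i s x /\ GC p i a E s x.

(* [a] bounds the indices of the keys in scope and [E] lists exceptional secret numbers.
   Neither occurs in [L], the part of the relation that survives a recursive call. *)
Fixpoint MM (p : nat) (s : ty) (a : nat) (E : exset) : mfam s -> Prop :=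
  match s return mfam s -> Prop with
  | TN => fun x => ev (fun i => low p i a (E i) TN (x i))
  | TArr b c => fun f =>
      if lv (TArr b c) <=? S p
      then ev (fun i => low p i a (E i) (TArr b c) (f i))
      else ev (fun i => GC p i a (E i) (TArr b c) (f i)) /\
           forall a' E', a <= a' -> inclE E E' -> bounded E' ->
             forall y, MM p b a' E' y -> MM p c a' E' (fun i => fapp (f i) (y i))
  end.

Lemma MM_low p s a E x :
  lv s <= S p -> (MM p s a E x <-> ev (fun i => low p i a (E i) s (x i))).
Proof.
  intro H. destruct s; [reflexivity|]. cbn [MM].
  destruct (Nat.leb_spec (lv (TArr s1 s2)) (S p)); [reflexivity|lia].
Qed.

Lemma MM_GC p s a E x : MM p s a E x -> ev (fun i => GC p i a (E i) s (x i)).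
Proof.
  destruct s; cbn [MM].
  - apply ev_imp. intros i []; auto.
  - destruct (_ <=? _); [|tauto]. apply ev_imp. intros i []; auto.
Qed.

Lemma MM_mono p s a a' E E' x :
  a <= a' -> inclE E E' -> MM p s a E x -> MM p s a' E' x.
Proof.
  intros La LE. destruct s; cbn [MM].
  - apply ev_imp. intros i []; split; auto. eapply GC_mono; eauto.
  - destruct (_ <=? _).
    + apply ev_imp. intros i []; split; auto. eapply GC_mono; eauto.
    + intros [H1 H2]. split.
      * revert H1. apply ev_imp. intro i. apply GC_mono; auto.
      * intros a'' E'' La' LE' B. apply H2; auto; [lia|]. eapply inclE_trans; eauto.
Qed.

Lemma MM_app p b c a E f y :
  bounded E -> MM p (TArr b c) a E f -> MM p b a E y -> MM p c a E (fun i => fapp (f i) (y i)).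
Proof.
  intros B Hf Hy. destruct (le_lt_dec (lv (TArr b c)) (S p)) as [Hl|Hl].
  - apply MM_low in Hf; auto. simpl in Hl. apply MM_low in Hy; [|lia]. apply MM_low; [lia|].
    eapply ev_imp; [|apply ev_and; [exact Hf|exact Hy]].
    intros i [[[H1 _] H2] [H3 H4]]. split; [now apply H1|]. now apply (GC_app p i a (E i) b c).
  - cbn [MM] in Hf. destruct (Nat.leb_spec (lv (TArr b c)) (S p)); [lia|].
    apply Hf; auto. apply inclE_refl.
Qed.

(* At low types, pointwise counterexamples assemble into a single family. *)
Lemma MM_intro p b c a E f :
  bounded E -> ev (fun i => GC p i a (E i) (TArr b c) (f i)) ->
  (forall a' E', a <= a' -> inclE E E' -> bounded E' ->
     forall y, MM p b a' E' y -> MM p c a' E' (fun i => fapp (f i) (y i))) ->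
  MM p (TArr b c) a E f.
Proof.
  intros B HG H. destruct (le_lt_dec (lv (TArr b c)) (S p)) as [Hl|Hl].
  2:{ cbn [MM]. destruct (Nat.leb_spec (lv (TArr b c)) (S p)); [lia|]. auto. }
  apply MM_low; auto. simpl in Hl.
  set (Bad := fun i (y : fam b) => L p i b y /\ ~ L p i c (fapp (f i) y)).
  (* [y i] is a counterexample at [i] whenever there is one, and some element of [L] otherwise. *)
  assert (Hy : exists y : mfam b, forall i, L p i b (y i) /\
                 ((exists z, Bad i z) -> Bad i (y i))).
  { exists (fun i => epsilon (inhabits (fun _ => bot b))
              (fun y => L p i b y /\ ((exists z, Bad i z) -> Bad i y))).
    intro i. apply epsilon_spec.
    destruct (classic (exists z, Bad i z)) as [[z Hz]|N].
    - exists z. split; [exact (proj1 Hz)|auto].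
    - exists (fun _ => bot b). split; [apply L_bot|tauto]. }
  destruct Hy as [y Hy].
  set (Q := fun i (g : nat -> A -> nat) =>
              forall a', GC p i a' (fun n => g n :: E i n) b (y i)).
  set (g := fun i => epsilon (inhabits (fun (_ : nat) (_ : A) => 0)) (Q i)).
  assert (Hg : ev (fun i => Q i (g i))).
  { eapply ev_imp; [|apply (ev_ge (tsize b))]. intros i Hi. apply epsilon_spec.
    apply (GC_of_all_in_scope p i b (y i) (E i)); [lia|auto|]. apply L_all_in_scope, (proj1 (Hy i)). }
  (* One more exceptional value per site brings [y] into [GC]. The [L] part of the conclusion does
     not mention [E'], so nothing is lost. *)
  set (E' := fun i n => g i n :: E i n).
  assert (M : MM p c a E' (fun i => fapp (f i) (y i))).
  { apply H; auto.
    - intros i n z Hz; now right.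
    - destruct B as [d Hd]. exists (S d). intros i n. simpl. specialize (Hd i n). lia.
    - apply MM_low; [lia|]. eapply ev_imp; [|exact Hg].
      intros i Hi. split; [exact (proj1 (Hy i))|apply Hi]. }
  apply MM_low in M; [|lia].
  eapply ev_imp; [|apply ev_and; [exact HG|exact M]].
  intros i [H1 [H2 _]]. split; auto. split; [|now apply (GC_all_in_scope p i a (E i))].
  intros z Hz. apply NNPP. intro N. destruct (Hy i) as [_ Hb].
  destruct Hb as [_ Hb]; [exists z; split; auto|]. auto.
Qed.

Lemma MM_TN p a E x :
  ev (fun i => tc (Ass p i) (x i)) -> ev (fun i => GC p i a (E i) TN (x i)) -> MM p TN a E x.
Proof.
  intros H1 H2. eapply ev_imp; [|apply ev_and; [exact H1|exact H2]].
  intros i [H3 H4]. split; auto. split; auto. now apply (GC_all_in_scope p i a (E i)).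
Qed.

Lemma MM_tc p a E x : MM p TN a E x -> ev (fun i => tc (Ass p i) (x i)).
Proof. apply ev_imp. now intros i [[H _] _]. Qed.

Lemma ev_GC_app p a E b c (f : mfam (TArr b c)) (y : mfam b) :
  ev (fun i => GC p i a (E i) (TArr b c) (f i)) -> ev (fun i => GC p i a (E i) b (y i)) ->
  ev (fun i => GC p i a (E i) c (fapp (f i) (y i))).
Proof.
  intros H1 H2. eapply ev_imp; [|apply ev_and; [exact H1|exact H2]].
  intros i []. now apply (GC_app p i a (E i) b c).
Qed.

(** The threshold on [i] must not depend on the number [m i] of unfoldings. A family of
    counterexamples shows that, from some [i] on, [f i] preserves [low]; the iteration then takes
    place at a fixed [i]. *)
Lemma MM_iter p s a E f (m : nat -> nat) :
  bounded E -> lv s <= S p -> MM p (TArr s s) a E f ->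
  MM p s a E (fun i r => iter (m i) (f i r) (bot s)).
Proof.
  intros B Hs Hf.
  assert (U : ev (fun i => forall x, low p i a (E i) s x -> low p i a (E i) s (fapp (f i) x))).
  { set (Bad := fun i (y : fam s) =>
                  low p i a (E i) s y /\ ~ low p i a (E i) s (fapp (f i) y)).
    assert (Hy : exists y : mfam s, forall i, low p i a (E i) s (y i) /\
                   ((exists z, Bad i z) -> Bad i (y i))).
    { exists (fun i => epsilon (inhabits (fun _ => bot s))
                (fun y => low p i a (E i) s y /\ ((exists z, Bad i z) -> Bad i y))).
      intro i. apply epsilon_spec.
      destruct (classic (exists z, Bad i z)) as [[z Hz]|N].
      - exists z. split; [exact (proj1 Hz)|auto].
      - exists (fun _ => bot s). split; [split; [apply L_bot|apply GC_bot]|tauto]. }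
    destruct Hy as [y Hy].
    assert (M : MM p s a E (fun i => fapp (f i) (y i))).
    { apply (MM_app p s s); auto. apply MM_low; auto. apply ev_all. intro i; exact (proj1 (Hy i)). }
    apply MM_low in M; auto. eapply ev_imp; [|exact M].
    intros i Hi x Hx. apply NNPP. intro N. destruct (Hy i) as [_ Hb].
    destruct Hb as [_ Hb]; [exists x; split; auto|]. auto. }
  apply MM_low; auto. eapply ev_imp; [|exact U]. intros i Hi.
  induction (m i) as [|d IH].
  - split; [apply L_bot|apply GC_bot].
  - exact (Hi _ IH).
Qed.

Lemma MM_const p a E (m : nat -> nat) c :
  bounded E -> const_fix_le (S p) c ->
  MM p (const_type c) a E (fun i _ => cden (m i) c).
Proof.
  intros B Hc.
  assert (G : forall a E, ev (fun i => GC p i a (E i) (const_type c) (fun _ => cden (m i) c))).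
  { intros. apply ev_all. intro i. apply GC_const. }
  destruct c; cbn [const_type] in *.
  - apply MM_TN; auto. apply ev_all. intro i. apply tc_const.
  - apply MM_intro; auto. intros a1 E1 La LE B1 x Hx. apply MM_TN.
    + eapply ev_imp; [|exact (MM_tc _ _ _ _ Hx)]. intros i Hi.
      apply (tc_bind _ (x i) (fun n => Some (S n))); auto.
    + apply (ev_GC_app p a1 E1 TN TN); auto. now apply MM_GC.
  - apply MM_intro; auto. intros a1 E1 La LE B1 x Hx. apply MM_TN.
    + eapply ev_imp; [|exact (MM_tc _ _ _ _ Hx)]. intros i Hi.
      apply (tc_bind _ (x i) (fun n => Some (pred n))); auto.
    + apply (ev_GC_app p a1 E1 TN TN); auto. now apply MM_GC.
  - apply MM_intro; auto. intros a1 E1 La1 LE1 B1 x Hx.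
    apply MM_intro; auto.
    { apply (ev_GC_app p a1 E1 TN (TArr TN (TArr TN TN))); auto. now apply MM_GC. }
    intros a2 E2 La2 LE2 B2 y Hy.
    apply (MM_mono _ _ _ _ _ _ _ La2 LE2) in Hx.
    apply MM_intro; auto.
    { apply (ev_GC_app p a2 E2 TN (TArr TN TN)); [|now apply MM_GC].
      apply (ev_GC_app p a2 E2 TN (TArr TN (TArr TN TN))); auto. now apply MM_GC. }
    intros a3 E3 La3 LE3 B3 z Hz.
    apply (MM_mono _ _ _ _ _ _ _ La3 LE3) in Hx.
    apply (MM_mono _ _ _ _ _ _ _ La3 LE3) in Hy.
    apply MM_TN.
    + eapply ev_imp; [|apply ev_and; [exact (MM_tc _ _ _ _ Hx)|
        apply ev_and; [exact (MM_tc _ _ _ _ Hy)|exact (MM_tc _ _ _ _ Hz)]]].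
      intros i (H1 & H2 & H3). exact (tc_ifz _ (x i) (y i) (z i) H1 H2 H3).
    + apply (ev_GC_app p a3 E3 TN TN); [|now apply MM_GC].
      apply (ev_GC_app p a3 E3 TN (TArr TN TN)); [|now apply MM_GC].
      apply (ev_GC_app p a3 E3 TN (TArr TN (TArr TN TN))); auto. now apply MM_GC.
  - apply MM_intro; auto. intros a1 E1 La LE B1 f Hf. now apply MM_iter.
  - apply MM_intro; auto. intros a1 E1 La LE B1 x Hx. apply MM_TN.
    + eapply ev_imp; [|exact (MM_tc _ _ _ _ Hx)]. intros i Hi.
      apply (tc_bind _ (x i) o); auto.
    + apply (ev_GC_app p a1 E1 TN TN); auto. now apply MM_GC.
Qed.

Definition slice (i : nat) (v : fval (nat * A)) : fval A :=
  existT (fun s => A -> D s) (projT1 v) (fun r => projT2 v (i, r)).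

Lemma at_index_slice i r e :
  map (at_index (i, r)) e = map (at_index r) (map (slice i) e).
Proof. rewrite map_map. reflexivity. Qed.

Definition MM_val (p a : nat) (E : exset) (v : fval (nat * A)) : Prop :=
  MM p (projT1 v) a E (fun i r => projT2 v (i, r)).

(** The fundamental lemma of [MM]. The fuel may depend on [i] in any way, thanks to [MM_iter]. *)
Lemma MM_den p (m : nat -> nat) G t s e a E :
  has_type G t s -> all_consts (const_fix_le (S p)) t -> ftypes e = G -> bounded E ->
  Forall (MM_val p a E) e ->
  MM p s a E (fun i r => den (m i) t s (map (at_index (i, r)) e)).
Proof.
  intro H; revert e a E; induction H; intros e a E Hc Ee B He; subst G.
  - destruct (nth_error_ftypes _ _ _ H) as [x Hx].
    replace (fun i r => den (m i) (Var n) s (map (at_index (i, r)) e))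
      with (fun i r => x (i, r)).
    + apply nth_error_In in Hx. rewrite Forall_forall in He. exact (He _ Hx).
    + extensionality i. extensionality r. symmetry. now apply den_var_at.
  - apply MM_intro; auto.
    + assert (X : ev (fun i => Forall (fun v => GC p i a (E i) (projT1 (slice i v))
                                  (projT2 (slice i v))) e)).
      { apply (ev_Forall (fun i v => GC p i a (E i) (projT1 (slice i v)) (projT2 (slice i v)))).
        eapply Forall_impl; [|exact He]. intros v Hv. exact (MM_GC _ _ _ _ _ Hv). }
      eapply ev_imp; [|exact X]. intros i Hi.
      replace (fun r => den (m i) (Lam s M) (TArr s t) (map (at_index (i, r)) e)) with
        (fun r => den (m i) (Lam s M) (TArr s t) (map (at_index r) (map (slice i) e)))
        by (extensionality r; now rewrite at_index_slice).
      apply (GC_den p i a (E i) (m i) (ftypes e)).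
      * now constructor.
      * unfold ftypes. now rewrite map_map.
      * now apply Forall_map.
    + intros a' E' La LE B' y Hy.
      apply (IHhas_type (existT (fun s => nat * A -> D s) s (fun ir => y (fst ir) (snd ir)) :: e));
        auto.
      constructor; [exact Hy|]. eapply Forall_impl; [|exact He].
      intros v Hv. eapply MM_mono; eauto.
  - destruct Hc as [Hc1 Hc2].
    replace (fun i r => den (m i) (App M N) t (map (at_index (i, r)) e)) with
      (fun i => fapp (fun r => den (m i) M (TArr s t) (map (at_index (i, r)) e))
                     (fun r => den (m i) N s (map (at_index (i, r)) e))).
    + apply (MM_app p s t a E
        (fun i r => den (m i) M (TArr s t) (map (at_index (i, r)) e))
        (fun i r => den (m i) N s (map (at_index (i, r)) e))); auto.
    + extensionality i. extensionality r. unfold fapp. rewrite (den_app _ _ _ s); auto.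
      now rewrite types_at_index.
  - replace (fun i r => den (m i) (Const c) (const_type c) (map (at_index (i, r)) e))
      with (fun i (_ : A) => cden (m i) c).
    + now apply MM_const.
    + extensionality i. extensionality r. now rewrite den_const.
Qed.

(** * Keys and the test functional in the relation [MM] *)

Lemma lv_pure j : lv (pure j) = j.
Proof. induction j; simpl; auto. rewrite IHj. lia. Qed.

Lemma L_pub p i j : L p i (pure j) (fun _ => pub j).
Proof.
  destruct j; split.
  - apply tc_const.
  - intros n _. apply K_TN_const.
  - intros y _. split; [apply tc_const|]. intros n _. apply K_TN_const.
  - intros n _. apply (K_pub p i n _ (S j)).
Qed.

Lemma L_probe p i j (x : fam (pure j)) :
  L p i (pure j) x ->
  tc (Ass p i) (match j return fam (pure j) -> fam TN with
        | 0 => fun x => x | S j' => fun x => fapp x (fun _ => pub j') end x).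
Proof.
  destruct j; intros [H _]; auto. apply (H (fun _ => pub j)), L_pub.
Qed.

Lemma in_scope_bits_vary p i n (y : fam TN) :
  2 <= i -> n <= i -> C p i n (Zw (S (S p))) y ->
  (forall r, Ass p i r -> y r = Some (r n (S p))) -> False.
Proof.
  intros Hi Hn H E. assert (Z := Ass_zero p i ltac:(lia)).
  destruct p as [|[|p]].
  - set (c := fun r : A => around 0 i n (fun j => j < 2) (fun _ _ => 0) r /\
                       (r n 0 = 0 \/ r n 0 = 1)).
    assert (X : forall v, v < 2 -> c (upd (fun _ _ => 0) n 1 v)).
    { intros v Hv. split.
      - apply around_upd; [now apply around_self|lia|]. rewrite bd_S; lia.
      - left. now rewrite upd_other by lia. }
    assert (Hc : cls 0 i n W2 c).
    { exists (fun _ _ => 0), 0, 1. repeat split; auto; lia. }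
    assert (Y := H c Hc (fun r Hr => ltac:(rewrite (E r (proj1 (proj1 Hr))); discriminate))
                   _ _ (X 0 ltac:(lia)) (X 1 ltac:(lia))).
    rewrite (E _ (proj1 (proj1 (X 0 ltac:(lia))))), (E _ (proj1 (proj1 (X 1 ltac:(lia))))),
      !upd_same in Y. discriminate.
  - apply (bits_vary 1 i n (fun j => j < 3) (fun _ _ => 0) y 1); auto.
    + apply H. simpl. eauto.
    + intros r [Hr _]. auto.
  - apply (bits_vary (S (S p)) i n (fun j => j < S (S (S (S p)))) (fun _ _ => 0) y (S (S p))); auto.
    + apply H. simpl. eauto.
    + intros r [Hr _]. auto.
Qed.

(** Answering with the bit would produce a family that satisfies [K] at [Zw (S (S p))] and yet
    reveals a bit unknown there; hence only the public answer is total. *)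
Lemma L_key p i n : 2 <= i -> n <= i -> L p i (pure (S p)) (keyf n (S p)).
Proof.
  intros Hi Hn.
  assert (S1 : all_in_scope p i (pure (S p)) (keyf n (S p))).
  { intros n' Hn'. destruct (Nat.eq_dec n n') as [->|]; [|now apply K_key_other].
    apply K_key; auto. destruct p as [|[|p]]; simpl; lia. }
  split; auto. intros y Hy.
  assert (S2 : all_in_scope p i TN (fapp (keyf n (S p)) y)).
  { intros n' Hn'. apply (K_app p i n' _ (pure p) TN); [now apply S1|].
    now apply L_all_in_scope in Hy; apply Hy. }
  split; auto. intros T r r' Hr Hr'.
  destruct (key_total_cases (Ass p i) n p y (L_probe _ _ _ _ Hy) T) as [H|H].
  - unfold fapp, keyf. now rewrite !H.
  - exfalso. apply (in_scope_bits_vary p i n (fapp (keyf n (S p)) y)); auto.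
    + apply K_base. now apply S2.
    + intros r0 H0. apply H; auto.
Qed.

Lemma MM_key p a E n : n <= a -> MM p (pure (S p)) a E (fun _ => keyf n (S p)).
Proof.
  intro Hn. apply MM_low; [now rewrite lv_pure|].
  eapply ev_imp; [|apply ev_and; [apply (ev_ge 2)|apply (ev_ge n)]].
  intros i [Hi Hni]. split; [now apply L_key|].
  intros n' w Hn' Hw. destruct (Nat.eq_dec n n') as [->|]; [|now apply K_key_other].
  destruct Hw as [->|[Ha _]]; [|lia].
  apply K_key; auto. destruct p as [|[|p]]; simpl; lia.
Qed.

Lemma MM_pub p a E : MM p (pure p) a E (fun _ _ => pub p).
Proof.
  apply MM_low; [rewrite lv_pure; lia|]. apply ev_all. intro i. split; [apply L_pub|].
  intros n w _ _. apply K_pub.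
Qed.

(** Totality makes the probe [h (pub p)] constant, so a single site [n] serves all assignments, and
    there every check of the walk succeeds. *)
Lemma walk_total p i (G : fam (pure (S (S p)))) (h : fam (pure (S p))) :
  tc (Ass p i) (fun r => h r (pub p)) ->
  (forall r, Ass p i r -> walk p i r (G r) (h r) <> None) ->
  1 <= i ->
  exists n, n <= i /\
    (forall r, Ass p i r -> h r (key r n p) = Some (r n (S p))) /\
    (n <> i -> forall r, Ass p i r -> G r (key r (S n) (S p)) = Some (r (S i) 1)).
Proof.
  intros H T Hi. assert (Z := Ass_zero p i Hi).
  assert (E : forall r r', Ass p i r -> Ass p i r' -> h r (pub p) = h r' (pub p)).
  { apply H. intros r Hr E. apply (T r Hr). unfold walk. now rewrite E. }
  destruct (h (fun _ _ => 0) (pub p)) as [v|] eqn:E0.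
  2:{ destruct (T _ Z). unfold walk. now rewrite E0. }
  exists (pred v).
  assert (X : forall r, Ass p i r -> pred v <= i /\ h r (key r (pred v) p) = Some (r (pred v) (S p)) /\
     (pred v <> i -> G r (key r (S (pred v)) (S p)) = Some (r (S i) 1))).
  { intros r Hr. specialize (T r Hr). unfold walk in T.
    rewrite (E r (fun _ _ => 0) Hr Z), E0 in T.
    destruct (Nat.leb_spec (pred v) i); [|congruence]. split; auto.
    destruct (h r (key r (pred v) p)) as [u|]; [|congruence].
    destruct (Nat.eqb_spec u (r (pred v) (S p))); [|congruence]. subst u. split; auto.
    intro N. destruct (Nat.eqb_spec (pred v) i); [congruence|].
    destruct (G r (key r (S (pred v)) (S p))) as [z|]; [|congruence].
    destruct (Nat.eqb_spec z (r (S i) 1)); congruence. }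
  split; [apply (X _ Z)|]. split; intros; apply X; auto.
Qed.

(** For large [i] the value is never total, so [tc] holds vacuously. A total walk would stand at one
    key [n]: beyond the scope, [h] could not have passed the check; within it, [G] at the key
    [n + 1] would be constant and yet equal to the varying answer. *)
Lemma MM_walk p a E :
  bounded E -> MM p (TArr (pure (S (S p))) (pure (S (S p)))) a E (fun i => walk p i).
Proof.
  intro B.
  assert (GW : forall a E, ev (fun i => GC p i a (E i) (TArr (pure (S (S p))) (pure (S (S p))))
                              (walk p i))).
  { intros. apply ev_all. intros i n w Hn _. now apply K_walk. }
  apply MM_intro; auto.
  intros a1 E1 _ _ B1 G HG.
  apply MM_intro; auto.
  { apply (ev_GC_app p a1 E1 (pure (S (S p))) (pure (S (S p)))); auto. now apply MM_GC. }
  intros a2 E2 La LE B2 h Hh.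
  (* The recursive call hands over the key [n + 1] for some [n <= a2], so [G] is moved to the scope
     [a2 + 1]. *)
  assert (HG2 : MM p (pure (S (S p))) (S a2) E2 G) by (eapply MM_mono; [| |exact HG]; auto).
  apply (MM_mono _ _ _ _ _ _ _ La LE) in HG.
  apply MM_TN.
  2:{ apply (ev_GC_app p a2 E2 (pure (S p)) TN); [|now apply MM_GC].
      apply (ev_GC_app p a2 E2 (pure (S (S p))) (pure (S (S p)))); auto. now apply MM_GC. }
  assert (H1 : ev (fun i => tc (Ass p i) (fapp (h i) (fun _ => pub p)))).
  { apply (MM_tc p a2 E2). apply (MM_app p (pure p) TN); auto. apply MM_pub. }
  assert (H2 : ev (fun i => forall n, n <= a2 -> tc (Ass p i) (fapp (G i) (keyf (S n) (S p))))).
  { apply ev_below. intros n Hn. apply (MM_tc p (S a2) E2).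
    apply (MM_app p (pure (S p)) TN (S a2) E2 G (fun _ => keyf (S n) (S p))); auto.
    apply MM_key. lia. }
  apply MM_GC in Hh. destruct B2 as [d Hd].
  (* The threshold exceeds [a2], so that no key in scope is the last one, and [d], the bound on the
     number of exceptional values. *)
  eapply ev_imp; [|apply ev_and; [exact H1|apply ev_and; [exact H2|apply ev_and;
    [exact Hh|apply (ev_ge (2 + a2 + d))]]]].
  intros i (X1 & X2 & X3 & Hi) T r r' Hr Hr'. exfalso.
  destruct (walk_total p i (G i) (h i) X1 T ltac:(lia)) as (n & Hn & Y1 & Y2).
  destruct (le_lt_dec n a2) as [Ha|Ha].
  - assert (Y3 := Y2 ltac:(lia)).
    assert (Z := Ass_zero p i ltac:(lia)).
    assert (Z1 : Ass p i (upd (fun _ _ => 0) (S i) 1 1)).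
    { apply Ass_upd; auto. rewrite bd_S; lia. }
    assert (W := X2 n Ha (fun r Hr => ltac:(unfold fapp, keyf; rewrite (Y3 r Hr); discriminate))
                   _ _ Z Z1).
    unfold fapp, keyf in W. rewrite !Y3, upd_same in W; auto. discriminate.
  - apply (out_of_scope_no_pass p i a2 (E2 i) n (h i)); auto; [lia|].
    specialize (Hd i n). lia.
Qed.

(** * No denotation solves all tests; uniform fuel *)

Lemma no_uniform_den p M (m : nat -> nat) :
  has_type [] M (TArr (TArr (pure (S (S p))) (pure (S (S p)))) (pure (S (S p)))) ->
  in_PCFOmega_k (S p) M ->
  (forall i r, 2 <= i -> Ass p i r ->
     den (m i) M (TArr (TArr (pure (S (S p))) (pure (S (S p)))) (pure (S (S p)))) []
       (walk p i r) (key r 0 (S p)) = Some (r (S i) 1)) -> False.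
Proof.
  intros T O H. set (E := (fun _ _ => []) : exset).
  assert (B : bounded E) by (exists 0; simpl; auto).
  assert (X := MM_den p m [] M _ [] 0 E T O eq_refl B (Forall_nil _)).
  assert (Y := MM_app p _ _ 0 E _ _ B X (MM_walk p 0 E B)).
  assert (Z := MM_app p (pure (S p)) TN 0 E _ _ B Y (MM_key p 0 E 0 (le_n 0))).
  apply MM_tc in Z. destruct Z as [N HN].
  set (i := N + 2). specialize (HN i ltac:(lia)). simpl in HN.
  assert (Z := Ass_zero p i ltac:(lia)).
  assert (Z1 : Ass p i (upd (fun _ _ => 0) (S i) 1 1)).
  { apply Ass_upd; auto. rewrite bd_S; lia. }
  assert (V := fun r => H i r ltac:(lia)). clear H. unfold fapp, keyf in HN.
  lapply HN; [|intros r Hr Er; specialize (V r Hr); simpl in *; congruence].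
  intro W. specialize (W _ _ Z Z1).
  assert (V1 := V _ Z1). rewrite upd_same in V1.
  assert (Q : Some 0 = Some 1) by exact (eq_trans (eq_sym (V _ Z)) (eq_trans W V1)).
  discriminate.
Qed.

(** Finitely many assignments have a common bound. The induction is on the list of positions at
    which [r] may still differ from [r0]. *)
Lemma Ass_uniform p i (P : nat -> A -> Prop) :
  (forall m m' r, m <= m' -> P m r -> P m' r) ->
  (forall r, Ass p i r -> exists m, P m r) ->
  exists m, forall r, Ass p i r -> P m r.
Proof.
  intros mono H.
  assert (X : forall l r0, exists m, forall r, Ass p i r ->
            (forall n j, ~ In (n, j) l -> r n j = r0 n j) -> P m r).
  { induction l as [|[n j] l IH]; intro r0.
    - destruct (classic (Ass p i r0)) as [A0|N].
      + destruct (H r0 A0) as [m Hm]. exists m. intros r Hr E.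
        replace r with r0; auto. extensionality n. extensionality j. symmetry. apply E. auto.
      + exists 0. intros r Hr E. destruct N. replace r0 with r; auto.
        extensionality n. extensionality j. apply E. auto.
    - assert (Y : forall b, exists m, forall r, Ass p i r -> r n j < b ->
                (forall n' j', ~ In (n', j') ((n, j) :: l) -> r n' j' = r0 n' j') -> P m r).
      { induction b as [|b [m1 IHb]]; [exists 0; intros; lia|].
        destruct (IH (upd r0 n j b)) as [m2 H2]. exists (m1 + m2). intros r Hr Hb E.
        destruct (Nat.eq_dec (r n j) b) as [Eb|].
        - apply (mono m2); [lia|]. apply H2; auto. intros n' j' N.
          destruct (classic (n' = n /\ j' = j)) as [[-> ->]|N'].
          + now rewrite upd_same.
          + rewrite upd_other by auto. apply E. intros [Q|Q]; auto. injection Q as -> ->. auto.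
        - apply (mono m1); [lia|]. apply IHb; auto. lia. }
      destruct (Y (bd p i n j)) as [m Hm]. exists m. intros r Hr E. apply Hm; auto. }
  destruct (X (list_prod (seq 0 (S (S i))) (seq 0 (S (S p)))) (fun _ _ => 0)) as [m Hm].
  exists m. intros r Hr. apply Hm; auto. intros n j N.
  specialize (Hr n j). unfold bd in Hr.
  destruct (Nat.leb_spec n (S i)); destruct (Nat.leb_spec j (S p)); simpl in Hr; try lia.
  destruct N. apply in_prod; apply in_seq; lia.
Qed.

(** * The tests as terms of PCF_0 *)

Definition omega : tm := App (Const (CY TN)) (Lam TN (Var 0)).

Definition ifz (t a b : tm) : tm := App (App (App (Const CIfz) t) a) b.

Fixpoint eqt (v : nat) (t a : tm) : tm :=
  match v with
  | 0 => ifz t a omega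
  | S v' => ifz t omega (eqt v' (App (Const CPre) t) a)
  end.

Fixpoint cases (t : tm) (l : list tm) : tm :=
  match l with
  | [] => omega
  | a :: l' => ifz t a (cases (App (Const CPre) t) l')
  end.

Definition pub_tm (j : nat) : tm :=
  match j with
  | 0 => num 0
  | S j' => Lam (pure j') (num 0)
  end.

Fixpoint key_tm (r : A) (n j : nat) : tm :=
  match j with
  | 0 => num (S (r n 0))
  | S j' =>
      Lam (pure j')
        match j' with
        | 0 => ifz (Var 0) (num (S n)) (eqt (S (r n 0)) (Var 0) (num (r n 1)))
        | S j'' =>
            ifz (App (Var 0) (pub_tm j'')) (num (S n))
              (eqt (r n (S j'')) (App (Var 0) (key_tm r n j'')) (num (r n (S (S j'')))))
        end
  end.

Definition walk_branch (p i : nat) (r : A) (n : nat) : tm :=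
  eqt (r n (S p)) (App (Var 0) (key_tm r n p))
    (if n =? i then num (r (S i) 1)
     else eqt (r (S i) 1) (App (Var 1) (key_tm r (S n) (S p))) (num (r (S i) 1))).

(** The secrets are numerals of the term, one branch for each key. [CPre] undoes the successor in
    the public answer [S n], and indices beyond [i] diverge. *)
Definition walk_tm (p i : nat) (r : A) : tm :=
  Lam (pure (S (S p))) (Lam (pure (S p))
    (cases (App (Const CPre) (App (Var 0) (pub_tm p))) (map (walk_branch p i r) (seq 0 (S i))))).

Lemma type_num G n : has_type G (num n) TN.
Proof. exact (T_Const G (CNum n)). Qed.

Lemma type_pre G t : has_type G t TN -> has_type G (App (Const CPre) t) TN.
Proof. intro H. eapply T_App; [exact (T_Const G CPre)|exact H]. Qed.

Lemma type_omega G : has_type G omega TN.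
Proof.
  eapply T_App; [exact (T_Const G (CY TN))|]. constructor. now constructor.
Qed.

Lemma type_ifz G t a b :
  has_type G t TN -> has_type G a TN -> has_type G b TN -> has_type G (ifz t a b) TN.
Proof.
  intros. eapply T_App; [|eassumption]. eapply T_App; [|eassumption].
  eapply T_App; [exact (T_Const G CIfz)|eassumption].
Qed.

Lemma type_eqt G v t a : has_type G t TN -> has_type G a TN -> has_type G (eqt v t a) TN.
Proof.
  revert t; induction v; simpl; intros; apply type_ifz; auto using type_omega, type_pre.
Qed.

Lemma type_cases G t l :
  has_type G t TN -> Forall (fun a => has_type G a TN) l -> has_type G (cases t l) TN.
Proof.
  intros Ht H; revert t Ht; induction H; simpl; intros.
  - apply type_omega.
  - apply type_ifz; auto using type_pre.
Qed.

Lemma type_pub G j : has_type G (pub_tm j) (pure j).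
Proof. destruct j; simpl; [|constructor]; apply type_num. Qed.

Lemma type_key G r n j : has_type G (key_tm r n j) (pure j).
Proof.
  revert G; induction j as [j IH] using lt_wf_ind; intro G.
  destruct j as [|[|j]]; [apply type_num| |]; constructor.
  - apply type_ifz; [now constructor|apply type_num|].
    apply type_eqt; [now constructor|apply type_num].
  - apply type_ifz; [|apply type_num|].
    + eapply T_App; [now constructor|apply type_pub].
    + apply type_eqt; [|apply type_num].
      eapply T_App; [now constructor|]. apply (IH j). lia.
Qed.

Lemma type_walk_branch G p i r n :
  has_type (pure (S p) :: pure (S (S p)) :: G) (walk_branch p i r n) TN.
Proof.
  apply type_eqt.
  - eapply T_App; [now constructor|apply (type_key _ r n p)].
  - destruct (n =? i); [apply type_num|]. apply type_eqt; [|apply type_num].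
    eapply T_App; [now constructor|apply (type_key _ r (S n) (S p))].
Qed.

Lemma type_walk G p i r :
  has_type G (walk_tm p i r) (TArr (pure (S (S p))) (pure (S (S p)))).
Proof.
  constructor. apply (T_Lam _ (pure (S p)) TN). apply type_cases.
  - apply type_pre. eapply T_App; [now constructor|apply type_pub].
  - apply Forall_map, Forall_forall. intros n _. apply type_walk_branch.
Qed.

Definition basic_const (c : const) : Prop :=
  match c with CY s => s = TN | COracle _ => False | _ => True end.

Lemma basic_eqt v t a :
  all_consts basic_const t -> all_consts basic_const a -> all_consts basic_const (eqt v t a).
Proof.
  revert t; induction v; simpl; intros; repeat split; auto. apply IHv; simpl; auto.
Qed.

Lemma basic_cases t l :
  all_consts basic_const t -> Forall (all_consts basic_const) l ->
  all_consts basic_const (cases t l).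
Proof.
  intros Ht H; revert t Ht; induction H; simpl; intros; repeat split; auto.
  apply IHForall; simpl; auto.
Qed.

Lemma basic_pub j : all_consts basic_const (pub_tm j).
Proof. destruct j; simpl; auto. Qed.

Lemma basic_key r n j : all_consts basic_const (key_tm r n j).
Proof.
  induction j as [j IH] using lt_wf_ind. destruct j as [|[|j]]; simpl; auto.
  - repeat split; auto. apply basic_eqt; simpl; auto.
  - repeat split; auto using basic_pub. apply basic_eqt; simpl; auto.
Qed.

Lemma basic_walk p i r : all_consts basic_const (walk_tm p i r).
Proof.
  cbn [walk_tm all_consts]. apply basic_cases; [simpl; auto using basic_pub|].
  apply Forall_map, Forall_forall. intros n _. apply basic_eqt; [split; [exact I|apply basic_key]|].
  destruct (n =? i); [exact I|]. apply basic_eqt; [|exact I].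
  split; [exact I|apply basic_key].
Qed.

Lemma all_consts_imp (P Q : const -> Prop) t :
  (forall c, P c -> Q c) -> all_consts P t -> all_consts Q t.
Proof. intro H; induction t; simpl; intuition. Qed.

Lemma basic_PCF_0 t : all_consts basic_const t -> in_PCF_k 0 t.
Proof.
  intro H; split; revert H; apply all_consts_imp; intros [] E; simpl in *; subst; auto.
Qed.

Lemma den_num m n e : den m (num n) TN e = Some n.
Proof. apply (den_const m (CNum n)). Qed.

Lemma den_pre m t e :
  has_type (types e) t TN ->
  den m (App (Const CPre) t) TN e =
  match den m t TN e with Some n => Some (pred n) | None => None end.
Proof. intro H. rewrite (den_app _ _ _ TN) by exact H. now rewrite (den_const m CPre). Qed.

Lemma den_omega m e : den m omega TN e = None.
Proof.
  unfold omega. rewrite (den_app _ _ _ (TArr TN TN)).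
  - rewrite (den_const m (CY TN)). simpl.
    induction m; simpl; auto.
  - constructor. now constructor.
Qed.

Lemma den_ifz m t a b e :
  has_type (types e) t TN -> has_type (types e) a TN -> has_type (types e) b TN ->
  den m (ifz t a b) TN e =
  match den m t TN e with
  | Some 0 => den m a TN e | Some (S _) => den m b TN e | None => None
  end.
Proof.
  intros. unfold ifz. rewrite !(den_app _ _ _ TN) by auto. now rewrite (den_const m CIfz).
Qed.

Lemma den_eqt m v t a e :
  has_type (types e) t TN -> has_type (types e) a TN ->
  den m (eqt v t a) TN e =
  match den m t TN e with
  | Some n => if n =? v then den m a TN e else None
  | None => None
  end.
Proof.
  revert t; induction v; intros t Ht Ha; cbn [eqt].
  - rewrite den_ifz, den_omega; auto using type_omega.
    destruct (den m t TN e) as [[|n]|]; auto.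
  - rewrite den_ifz, den_omega; auto using type_omega, type_eqt, type_pre.
    rewrite IHv, den_pre; auto using type_pre.
    destruct (den m t TN e) as [[|n]|]; auto.
Qed.

Lemma den_cases m t l e :
  has_type (types e) t TN -> Forall (fun a => has_type (types e) a TN) l ->
  den m (cases t l) TN e =
  match den m t TN e with
  | Some n => nth n (map (fun a => den m a TN e) l) None
  | None => None
  end.
Proof.
  intros Ht H; revert t Ht; induction H; intros t Ht; cbn [cases map].
  - rewrite den_omega. destruct (den m t TN e) as [[|n]|]; auto.
  - rewrite den_ifz; auto using type_cases, type_pre.
    rewrite IHForall, den_pre; auto using type_pre.
    destruct (den m t TN e) as [[|n]|]; auto.
Qed.

Lemma den_var0 m s x e : den m (Var 0) s (existT D s x :: e) = x.
Proof. apply coerce_same. Qed.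

Lemma den_pub m j e : den m (pub_tm j) (pure j) e = pub j.
Proof.
  destruct j; [apply den_num|]. extensionality x. exact (den_num m 0 (existT D _ x :: e)).
Qed.

Lemma den_key m r n j e : den m (key_tm r n j) (pure j) e = key r n j.
Proof.
  revert e; induction j as [j IH] using lt_wf_ind; intro e.
  destruct j as [|[|j]]; cbn [key_tm]; [apply den_num| |]; extensionality x.
  - change (den m (Lam (pure 0) (ifz (Var 0) (num (S n))
      (eqt (S (r n 0)) (Var 0) (num (r n 1))))) (pure 1) e x) with
      (den m (ifz (Var 0) (num (S n))
      (eqt (S (r n 0)) (Var 0) (num (r n 1)))) TN (existT D TN x :: e)).
    assert (T : has_type (types (existT D TN x :: e)) (Var 0) TN) by now constructor.
    rewrite den_ifz, den_num, den_eqt, den_num, den_var0;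
      auto using type_num, type_eqt.
    simpl. destruct x as [[|q]|]; reflexivity.
  - match goal with |- den m (Lam ?a ?t) _ e x = _ =>
      change (den m (Lam a t) (pure (S (S j))) e x) with (den m t TN (existT D a x :: e)) end.
    assert (T : has_type (types (existT D (pure (S j)) x :: e)) (Var 0) (TArr (pure j) TN))
      by now constructor.
    assert (T1 := fun t H => T_App _ _ _ _ t T H).
    rewrite den_ifz, den_num, den_eqt, den_num;
      auto using type_num, type_eqt, type_pub, type_key.
    rewrite !(den_app _ _ _ (pure j)); auto using type_pub, type_key.
    rewrite den_pub, IH by lia. change (TArr (pure j) TN) with (pure (S j)).
    rewrite den_var0. simpl. reflexivity.
Qed.

Lemma nth_map_seq {X : Type} (f : nat -> X) n b d :
  nth n (map f (seq 0 (S b))) d = if n <=? b then f n else d.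
Proof.
  destruct (Nat.leb_spec n b).
  - rewrite nth_indep with (d' := f 0) by (rewrite length_map, length_seq; lia).
    rewrite map_nth, seq_nth; auto. lia.
  - apply nth_overflow. rewrite length_map, length_seq. lia.
Qed.

Lemma den_walk m p i r e :
  den m (walk_tm p i r) (TArr (pure (S (S p))) (pure (S (S p)))) e = walk p i r.
Proof.
  extensionality G. extensionality h. unfold walk_tm.
  match goal with |- den m (Lam _ (Lam _ ?t)) _ e G h = _ =>
    change (den m t TN (existT D (pure (S p)) h :: existT D (pure (S (S p))) G :: e)
            = walk p i r G h) end.
  set (e' := existT D (pure (S p)) h :: existT D (pure (S (S p))) G :: e).
  assert (T0 : has_type (types e') (Var 0) (TArr (pure p) TN)) by now constructor.
  assert (T1 : has_type (types e') (Var 1) (TArr (pure (S p)) TN)) by now constructor.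
  assert (D0 : forall m, den m (Var 0) (TArr (pure p) TN) e' = h)
    by (intro; exact (coerce_same (pure (S p)) h)).
  assert (D1 : forall m, den m (Var 1) (TArr (pure (S p)) TN) e' = G)
    by (intro; exact (coerce_same (pure (S (S p))) G)).
  assert (X0 := fun t H => T_App _ _ _ _ t T0 H).
  assert (X1 := fun t H => T_App _ _ _ _ t T1 H).
  rewrite den_cases; auto using type_pre, type_pub.
  2:{ apply Forall_map, Forall_forall. intros n _. apply type_walk_branch. }
  rewrite den_pre, (den_app _ _ _ (pure p)), D0, den_pub; auto using type_pub.
  unfold walk. destruct (h (pub p)) as [v|]; auto.
  rewrite map_map, nth_map_seq. destruct (pred v <=? i); auto.
  unfold walk_branch.
  rewrite den_eqt, (den_app _ _ _ (pure p)), D0, den_key; auto using type_key.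
  2:{ destruct (_ =? i); auto using type_num, type_eqt, type_key. }
  destruct (h (key r (pred v) p)) as [u|]; auto. destruct (u =? _); auto.
  destruct (pred v =? i); [apply den_num|].
  rewrite den_eqt, (den_app _ _ _ (pure (S p))), D1, den_key, den_num; auto using type_num.
  - now apply (type_key _ r (S (pred v)) (S p)).
  - apply X1. apply (type_key _ r (S (pred v)) (S p)).
Qed.

(** * Evaluation of the fixed point operators on the tests *)

Lemma key_at_pub r n j : key r n (S j) (pub j) = Some (S n).
Proof. destruct j; reflexivity. Qed.

Lemma key_at_key r n j : key r n (S j) (key r n j) = Some (r n (S j)).
Proof.
  induction j.
  - simpl. now rewrite Nat.eqb_refl.
  - change (key r n (S (S j)) (key r n (S j))) with
      (match key r n (S j) (pub j) with
       | None => None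
       | Some 0 => Some (S n)
       | Some (S _) =>
           match key r n (S j) (key r n j) with
           | None => None
           | Some v => if v =? r n (S j) then Some (r n (S (S j))) else None
           end
       end).
    now rewrite key_at_pub, IHj, Nat.eqb_refl.
Qed.

(** The list has [i - n + 1] keys from the key [n] on, and each takes one unfolding. *)
Lemma iter_walk p i r m n :
  n <= i -> i < n + m ->
  iter m (walk p i r) (bot (pure (S (S p)))) (key r n (S p)) = Some (r (S i) 1).
Proof.
  revert n; induction m; intros n Hn Hm; [lia|].
  cbn [iter]. unfold walk at 1. rewrite key_at_pub. cbn [pred].
  destruct (Nat.leb_spec n i); [|lia].
  rewrite key_at_key, Nat.eqb_refl. destruct (Nat.eqb_spec n i); auto.
  rewrite IHm by lia. now rewrite Nat.eqb_refl.
Qed.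

(** Each reduction provides some fuel; as the assignments are finite in number, one fuel [m i]
    serves all tests with the same [i]. *)
Lemma no_test_solver p M :
  has_type [] M (TArr (TArr (pure (S (S p))) (pure (S (S p)))) (pure (S (S p)))) ->
  in_PCFOmega_k (S p) M ->
  (forall i r, Ass p i r ->
     steps (App (App M (walk_tm p i r)) (key_tm r 0 (S p))) (num (r (S i) 1))) -> False.
Proof.
  intros T O H. set (s := pure (S (S p))) in *.
  set (P := fun i m r => forall m', m <= m' ->
    den m' M (TArr (TArr s s) s) [] (walk p i r) (key r 0 (S p)) = Some (r (S i) 1)).
  assert (U : forall i, exists m, forall r, Ass p i r -> P i m r).
  { intro i. apply Ass_uniform.
    - intros m m' r L Hm m'' L'. apply Hm. lia.
    - intros r Hr. destruct (den_steps_num _ _ (H i r Hr)) as [m Hm].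
      + eapply T_App; [eapply T_App; [exact T|apply type_walk]|exact (type_key [] r 0 (S p))].
      + exists m. intros m' L. rewrite <- (Hm m' L).
        rewrite (den_app _ _ _ (pure (S p))) by exact (type_key [] r 0 (S p)).
        change (TArr (pure (S p)) TN) with s.
        rewrite (den_app _ _ _ (TArr s s)) by apply type_walk.
        unfold s. now rewrite den_walk, den_key. }
  apply (no_uniform_den p M (fun i => epsilon (inhabits 0)
           (fun m => forall r, Ass p i r -> P i m r)) T O).
  intros i r _ Hr.
  apply (epsilon_spec (inhabits 0) (fun m => forall r, Ass p i r -> P i m r) (U i) r Hr). auto.
Qed.

Lemma steps_Y_walk p i r :
  steps (App (App (Const (CY (pure (S (S p))))) (walk_tm p i r)) (key_tm r 0 (S p)))
        (num (r (S i) 1)).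
Proof.
  set (s := pure (S (S p))).
  assert (TY : has_type [] (App (Const (CY s)) (walk_tm p i r)) (TArr (pure (S p)) TN)).
  { eapply T_App; [exact (T_Const [] (CY s))|apply type_walk]. }
  apply (adequacy (S i)).
  - eapply T_App; [exact TY|apply type_key].
  - split; [split; [exact I|]|]; apply basic_PCF_0; [apply basic_walk|apply basic_key].
  - rewrite (den_app _ _ _ (pure (S p))) by exact (type_key [] r 0 (S p)).
    change (TArr (pure (S p)) TN) with s.
    rewrite (den_app _ _ _ (TArr s s)) by apply type_walk.
    change (TArr (TArr s s) s) with (const_type (CY s)). rewrite den_const.
    unfold s. rewrite den_walk, den_key. apply iter_walk; lia.
Qed.

(** A dummy number turns a test for [pure (p + 2)] into one for [TArr TN (pure (p + 2))]; recursive
    calls pass 0. *)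
Definition walkN_tm (p : nat) (w : tm) : tm :=
  Lam (TArr TN (pure (S (S p)))) (Lam TN (App w (App (Var 1) (num 0)))).

Lemma type_walkN p i r :
  has_type [] (walkN_tm p (walk_tm p i r))
    (TArr (TArr TN (pure (S (S p)))) (TArr TN (pure (S (S p))))).
Proof.
  repeat constructor. eapply T_App; [apply type_walk|].
  eapply T_App; [now constructor|apply type_num].
Qed.

Lemma basic_walkN p i r : all_consts basic_const (walkN_tm p (walk_tm p i r)).
Proof. split; [apply basic_walk|simpl; auto]. Qed.

Lemma den_walkN m p i r G v :
  den m (walkN_tm p (walk_tm p i r))
    (TArr (TArr TN (pure (S (S p)))) (TArr TN (pure (S (S p))))) [] G v
  = walk p i r (G (Some 0)).
Proof.
  set (e := [existT D TN v; existT D (TArr TN (pure (S (S p)))) G]).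
  change (den m (App (walk_tm p i r) (App (Var 1) (num 0))) (pure (S (S p))) e
          = walk p i r (G (Some 0))).
  assert (T1 : has_type (types e) (Var 1) (TArr TN (pure (S (S p))))) by now constructor.
  rewrite (den_app _ _ _ (pure (S (S p)))).
  - rewrite den_walk, (den_app _ _ _ TN) by apply type_num. rewrite den_num. do 2 f_equal.
    exact (f_equal (fun f => f (Some 0)) (coerce_same (TArr TN (pure (S (S p)))) G)).
  - eapply T_App; [exact T1|apply type_num].
Qed.

Lemma steps_Y_walkN p i r :
  steps (App (App (App (Const (CY (TArr TN (pure (S (S p)))))) (walkN_tm p (walk_tm p i r)))
           (num 0)) (key_tm r 0 (S p)))
        (num (r (S i) 1)).
Proof.
  set (s0 := pure (S (S p))). set (s := TArr TN s0).
  assert (TY : has_type [] (App (Const (CY s)) (walkN_tm p (walk_tm p i r))) s).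
  { eapply T_App; [exact (T_Const [] (CY s))|apply type_walkN]. }
  apply (adequacy (S i)).
  - eapply T_App; [eapply T_App; [exact TY|apply type_num]|exact (type_key [] r 0 (S p))].
  - split; [split; [split; [exact I|]|exact I]|]; apply basic_PCF_0;
      [apply basic_walkN|apply basic_key].
  - rewrite (den_app _ _ _ (pure (S p))) by exact (type_key [] r 0 (S p)).
    rewrite (den_app _ _ _ TN) by apply type_num.
    change (TArr TN (TArr (pure (S p)) TN)) with s.
    rewrite (den_app _ _ _ (TArr s s)) by apply type_walkN.
    change (TArr (TArr s s) s) with (const_type (CY s)). rewrite den_const.
    rewrite den_num, den_key.
    assert (X : forall j, iter j (den (S i) (walkN_tm p (walk_tm p i r)) (TArr s s) []) (bot s) (Some 0)
                = iter j (walk p i r) (bot s0)).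
    { induction j; [reflexivity|]. cbn [iter]. unfold s, s0. rewrite den_walkN.
      exact (f_equal (walk p i r) IHj). }
    cbn [cden]. rewrite X. apply iter_walk; lia.
Qed.

(** * From observational equivalence to the tests *)

Fixpoint emb (t : tm) : ctx :=
  match t with
  | Var n => CVar n
  | Lam s t => CLam s (emb t)
  | App t u => CApp (emb t) (emb u)
  | Const c => CConst c
  end.

Lemma plug_emb t M : plug (emb t) M = t.
Proof. induction t; simpl; congruence. Qed.

Lemma ctx_typed_emb G t s h : has_type G t s -> ctx_typed G (emb t) h s.
Proof. induction 1; simpl; econstructor; eauto. Qed.

(** Closed arguments make [[-] N_0 ... N_(r-1)] a closed program context. *)
Lemma obs_equiv_sim0 s M M' : obs_equiv s M M' -> sim0 s M M'.
Proof.
  intros H Ns Hok n.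
  assert (X : forall s' C, ctx_typed [] C s s' -> args_ok s' Ns ->
            exists C', ctx_typed [] C' s TN /\ forall N, plug C' N = apps (plug C N) Ns).
  { clear H n Hok. intros s' C HC Hs. revert s' C HC Hs.
    induction Ns as [|N Ns IH]; intros [|b c] C HC Hs; simpl in Hs; try contradiction.
    - exists C. auto.
    - destruct Hs as [[HN _] Hs].
      destruct (IH c (CApp C (emb N))) as (C' & H1 & H2); auto.
      + econstructor; [exact HC|]. now apply ctx_typed_emb.
      + exists C'. split; auto. intro N0. rewrite H2. simpl. now rewrite plug_emb. }
  destruct (X s CHole (CT_Hole [] s) Hok) as (C' & H1 & H2).
  specialize (H C' H1 n). now rewrite !H2 in H.
Qed.

Lemma Y_pure_not_definable p M :
  has_type [] M (TArr (TArr (pure (S (S p))) (pure (S (S p)))) (pure (S (S p)))) ->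
  in_PCFOmega_k (S p) M ->
  ~ sim0 (TArr (TArr (pure (S (S p))) (pure (S (S p)))) (pure (S (S p)))) M
      (Const (CY (pure (S (S p))))).
Proof.
  intros T O H. apply (no_test_solver p M T O). intros i r _.
  apply (H [walk_tm p i r; key_tm r 0 (S p)]).
  - split; [split; [apply type_walk|apply basic_PCF_0, basic_walk]|].
    split; [split; [apply (type_key [] r 0 (S p))|apply basic_PCF_0, basic_key]|exact I].
  - apply steps_Y_walk.
Qed.

Lemma Y_N_pure_not_definable p M :
  let s := TArr TN (pure (S (S p))) in
  has_type [] M (TArr (TArr s s) s) -> in_PCFOmega_k (S p) M ->
  ~ sim0 (TArr (TArr s s) s) M (Const (CY s)).
Proof.
  intros s T O H. set (s0 := pure (S (S p))).
  (* [M'] would do the work of [Y] at [pure (S (S p))]; [Var 2] reaches its own bound variable past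
     the two binders of [walkN_tm]. *)
  set (M' := Lam (TArr s0 s0) (App (App M (walkN_tm p (Var 2))) (num 0))).
  apply (no_test_solver p M').
  - constructor. eapply T_App; [eapply T_App|apply type_num].
    + apply closed_weaken. exact T.
    + repeat constructor. eapply T_App; [now constructor|].
      eapply T_App; [now constructor|apply type_num].
  - repeat split; auto.
  - intros i r _.
    eapply steps_step; [apply S_AppL, S_Beta|].
    cbn [subst walkN_tm shift]. rewrite (subst_closed M _ _ _ T).
    rewrite !(shift_closed (walk_tm p i r) _ _ (type_walk [] p i r)).
    apply (H [walkN_tm p (walk_tm p i r); num 0; key_tm r 0 (S p)]).
    + split; [split; [apply type_walkN|apply basic_PCF_0, basic_walkN]|].
      split; [split; [apply type_num|now apply basic_PCF_0]|].
      split; [split; [apply (type_key [] r 0 (S p))|apply basic_PCF_0, basic_key]|exact I].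
    + apply steps_Y_walkN.
Qed.

Theorem theorem2p1 (k : nat) (hk : 1 <= k) :
  (forall M : tm,
      let s := TArr TN (pure (k + 1)) in
      has_type nil M (TArr (TArr s s) s) -> in_PCFOmega_k k M ->
      ~ obs_equiv (TArr (TArr s s) s) M (Const (CY s)) /\
      ~ sim0 (TArr (TArr s s) s) M (Const (CY s))) /\
  (forall M : tm,
      let s := pure (k + 1) in
      has_type nil M (TArr (TArr s s) s) -> in_PCFOmega_k k M ->
      ~ obs_equiv (TArr (TArr s s) s) M (Const (CY s))).
Proof.
  (* With [k = S p] the keys have type [pure k], and continuations have type [pure (k + 1)]. *)
  rewrite Nat.add_1_r. destruct k as [|p]; [lia|]. split; intros M s T O.
  - assert (X := Y_N_pure_not_definable p M T O). split; [|exact X].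
    intro H. apply X. now apply obs_equiv_sim0.
  - intro H. apply (Y_pure_not_definable p M T O). now apply obs_equiv_sim0.
Qed.
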